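(* For $\delta>0$, let $\phi_\delta:\mathbb{R}^n\to\mathbb{R}^m$ be the feedback control corresponding to the distributed data-based predictive control algorithm described in the context (with tolerance $\delta$). Assume that (1) $(A,B)$ is controllable and the collected data $w^d=\mathrm{col}(u^d,x^d)$ is a trajectory of the network system such that either (i) $u^d$ is persistently exciting of order $n+\tau$, or (ii) $\mathrm{col}(u_i^d,x^d_{\mathcal{N}_i})$ is persistently exciting of order $n_i+\tau$ for each $i\in S$ and $x^d_{\mathcal{N}_i}$ is persistently exciting of order $n_i+\tau$ for each $i\in\mathcal{V}\setminus S$; and (2) the data-based optimization problem (P) of the context is feasible for all $(u^{\mathrm{ini}},x^{\mathrm{ini}})$ which is a valid $T_{\mathrm{ini}}$-sample long system trajectory. Then there exists $\delta^*>0$ such that for all $\delta<\delta^*$ the origin is globally asymptotically stable with respect to the closed-loop dynamics $x(t+1)=Ax(t)+B\phi_\delta(x(t))$.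
   Context: Notation: $[a,b]=\{a,\dots,b\}$ for integers $a<b$. $\mathrm{col}$ denotes vertical stacking; signals on finite intervals are identified with the stacked vectors of their samples, and for signals on the same interval in the definition of trajectories and data $\mathrm{col}(v_1,v_2)(t)=\mathrm{col}(v_1(t),v_2(t))$. $\|x\|_Q=\sqrt{x^{\mathsf T}Qx}$ for $Q\succeq0$. For a signal $w:[0,T_d-1]\to\mathbb{R}^k$, the Hankel matrix $\mathcal{H}_\tau(w)\in\mathbb{R}^{k\tau\times(T_d-\tau+1)}$ has $(a,b)$ block entry $w(a+b)$, $a\in[0,\tau-1]$, $b\in[0,T_d-\tau]$. The signal is persistently exciting of order $t$ if $\mathcal{H}_t(w)$ has row rank $kt$. Network system: $\mathcal{G}=(\mathcal{V},\mathcal{E})$ is an undirected graph, $\mathcal{V}=[1,N]$, with neighbor sets $\mathcal{N}_i=\{j:(i,j)\in\mathcal{E}\}$, and $S\subset\mathcal{V}$ is the set of actuated nodes. Node $i$ has state $x_i\in\mathbb{R}^{n_i}$ and, if $i\in S$, input $u_i\in\mathbb{R}^{m_i}$, with dynamics $x_i(t+1)=A_{ii}x_i(t)+\sum_{j\in\mathcal{N}_i}A_{ij}x_j(t)+B_iu_i(t)$ for $i\in S$ and the same without the term $B_iu_i(t)$ for $i\notin S$. With $x=\mathrm{col}(x_1,\dots,x_N)\in\mathbb{R}^n$ and $u\in\mathbb{R}^m$ the stack of $u_i$, $i\in S$, the compact form is $x(t+1)=Ax(t)+Bu(t)$. A signal $\mathrm{col}(u,x)$ is a trajectory if it satisfies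 these dynamics on its time interval. $x_{\mathcal{N}_i}$ denotes the stack of $x_j$, $j\in\mathcal{N}_i$. Data: $u^d:[0,T_d-1]\to\mathbb{R}^m$, $x^d:[0,T_d-1]\to\mathbb{R}^n$, sampled from one trajectory. Fix the time horizon $T$ and $T_{\mathrm{ini}}>0$, and let $\tau=T_{\mathrm{ini}}+T+1$. Define $H_i$ as the vertical stack of $\mathcal{H}_\tau(u_i^d)$, $\mathcal{H}_\tau(x^d_{\mathcal{N}_i})$, $\mathcal{H}_\tau(x_i^d)$ if $i\in S$, and of $\mathcal{H}_\tau(x^d_{\mathcal{N}_i})$, $\mathcal{H}_\tau(x_i^d)$ if $i\notin S$. Objectives: $J_i(x_i,u_i)=\sum_{t=0}^{T-1}\left(\|x_i(t)\|_{Q_i}^2+\|u_i(t)\|_{R_i}^2\right)$ for $i\in S$, and $J_i(x_i)=\sum_{t=0}^{T-1}\|x_i(t)\|_{Q_i}^2$ for $i\notin S$, where $Q_i\in\mathbb{R}^{n_i\times n_i}$ is positive semidefinite and $R_i\in\mathbb{R}^{m_i\times m_i}$ is positive definite. Problem (P), for given $u^{\mathrm{ini}}:[0,T_{\mathrm{ini}}-1]\to\mathbb{R}^m$ and $x^{\mathrm{ini}}:[0,T_{\mathrm{ini}}-1]\to\mathbb{R}^n$ such that $\mathrm{col}(u^{\mathrm{ini}},x^{\mathrm{ini}})$ is a trajectory: minimize over $g=(g_i)$, $u=(u_i)_{i\in S}$, $x=(x_i)_{i\in\mathcal{V}}$ the cost $\sum_{i\in S}J_i(x_i,u_i)+\sum_{i\in\mathcal{V}\setminus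 S}J_i(x_i)$ subject to $H_ig_i=\mathrm{col}(u_i^{\mathrm{ini}},u_i,x^{\mathrm{ini}}_{\mathcal{N}_i},x_{\mathcal{N}_i},x_i^{\mathrm{ini}},x_i)$ for $i\in S$; $H_ig_i=\mathrm{col}(x^{\mathrm{ini}}_{\mathcal{N}_i},x_{\mathcal{N}_i},x_i^{\mathrm{ini}},x_i)$ for $i\notin S$; and $x_i(T)=0$ for all $i\in\mathcal{V}$. (In $H_ig_i=\mathrm{col}(\cdot)$, each signal is stacked over time, the initial segment of $T_{\mathrm{ini}}$ samples preceding the future samples, indexed from $0$.) Let $u^*$ denote the optimal input sequence of (P) on $[0,T-1]$; it is the optimal input sequence of the LQR problem of minimizing $\sum_{t=0}^{T-1}\left(\|x(t)\|_Q^2+\|u(t)\|_R^2\right)$, with $Q,R$ the block-diagonal matrices of the $Q_i$ and $R_i$, subject to $x(t+1)=Ax(t)+Bu(t)$, $x(0)=Ax^{\mathrm{ini}}(T_{\mathrm{ini}}-1)+Bu^{\mathrm{ini}}(T_{\mathrm{ini}}-1)$ and $x(T)=0$. Algorithm with tolerance $\delta$: at each time $t$, as long as $\|x\|>0$, let $u^{\mathrm{ini}}$ and $x^{\mathrm{ini}}$ be the $T_{\mathrm{ini}}$ most recent inputs and states of the system (so the last entries are $u(t-1)$, $x(t-1)$, and the current state is $x(t)=Ax^{\mathrm{ini}}(T_{\mathrm{ini}}-1)+Bu^{\mathrm{ini}}(T_{\mathrm{ini}}-1)$); obtain, by any distributed optimization algorithm, an approximate solution $\hat z=\mathrm{col}(\hat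 g,\hat u,\hat x)$ of (P) such that $\|\hat u-u^*\|\le\delta\min\{1,\|x^{\mathrm{ini}}(T_{\mathrm{ini}}-1)\|\}$; apply the input $\hat u(0)$; and increment $t$. The feedback $\phi_\delta(x(t))$ is the input $\hat u(0)$ so applied when the current state is $x(t)$; the algorithm stops once $x=0$, i.e. $\phi_\delta(0)=0$. *)

(* Defs.v *)
From HB Require Import structures.
From mathcomp Require Import all_boot all_order all_algebra.
From mathcomp Require Import all_classical all_reals all_analysis.

Set Implicit Arguments.
Unset Strict Implicit.
Unset Printing Implicit Defensive.

Import Order.TTheory GRing.Theory Num.Theory.
Import numFieldNormedType.Exports.

Local Open Scope classical_set_scope.
Local Open Scope ring_scope.

(* A signal on [0, L-1] is a function on nat of which only the first L samples
   are ever used. *)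
Notation signal R k := (nat -> 'cV[R]_k).

Section Norms.
Context {R : realType}.

(* mathcomp-analysis's norm on matrices is the max norm. *)
Definition enorm {k} (v : 'cV[R]_k) : R := Num.sqrt (\sum_(i < k) v i 0 ^+ 2).

Definition wnorm {k} (Q : 'M[R]_k) (v : 'cV[R]_k) : R :=
  Num.sqrt ((v^T *m Q *m v) 0 0).

Definition psd {k} (Q : 'M[R]_k) : Prop :=
  Q^T = Q /\ forall v : 'cV[R]_k, 0 <= (v^T *m Q *m v) 0 0.

Definition posdef {k} (Q : 'M[R]_k) : Prop :=
  Q^T = Q /\ forall v : 'cV[R]_k, v != 0 -> 0 < (v^T *m Q *m v) 0 0.

End Norms.

Section Signals.
Context {R : realType}.

Definition stackt {k} (L : nat) (w : signal R k) : 'cV[R]_(\sum_(a < L) k) :=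
  \mxcol_(a < L) w a.

Definition concat {k} (L : nat) (w1 w2 : signal R k) : signal R k :=
  fun t => if (t < L)%N then w1 t else w2 (t - L)%N.

(* Td.+1 - order is the truncated difference: when the data are shorter than
   the order, the matrix has no column. *)
Definition hankel {k} (Td order : nat) (w : signal R k)
    : 'M[R]_(\sum_(a < order) k, Td.+1 - order) :=
  \mxcol_(a < order) \matrix_(r < k, b < Td.+1 - order) w (a + b)%N r 0.

Definition persistently_exciting {k} (Td order : nat) (w : signal R k) : Prop :=
  \rank (hankel Td order w) = (k * order)%N.

End Signals.

Section LinearSystems.
Context {R : realType} {n m : nat} (A : 'M[R]_n) (B : 'M[R]_(n, m)).

Definition trajectory (L : nat) (u : signal R m) (x : signal R n) : Prop :=
  forall t, (t.+1 < L)%N -> x t.+1 = A *m x t + B *m u t.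

Definition controllable : Prop :=
  forall x0 x1 : 'cV[R]_n, exists (L : nat) (u : signal R m) (x : signal R n),
    [/\ trajectory L.+1 u x, x 0%N = x0 & x L = x1].

End LinearSystems.

Definition globally_asymptotically_stable {R : realType} {n : nat}
    (f : 'cV[R]_n -> 'cV[R]_n) : Prop :=
  (forall eps : R, 0 < eps -> exists2 d : R, 0 < d &
     forall x0, enorm x0 < d -> forall t, enorm (iter t f x0) < eps) /\
  (forall x0, enorm (iter t f x0) @[t --> \oo] --> (0 : R)).

(* Aij i j is used only for j = i and for neighbors j of i;
   udim i and Bi i are used only for actuated nodes i. *)
Record network (R : realType) := Network {
  nnodes : nat;
  edge : rel 'I_nnodes;
  edge_sym : symmetric edge;
  edge_irr : irreflexive edge;
  act : {set 'I_nnodes};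
  xdim : 'I_nnodes -> nat;
  udim : 'I_nnodes -> nat;
  Aij : forall i j : 'I_nnodes, 'M[R]_(xdim i, xdim j);
  Bi : forall i : 'I_nnodes, 'M[R]_(xdim i, udim i) }.

Section Network.
Context {R : realType} (net : network R).

Local Notation node := 'I_(nnodes net).
Local Notation S := (act net).

(* Actuated nodes are enumerated as enum_val k with k : 'I_#|S|, and the
   components of an input are indexed by k. *)
Definition actn (k : 'I_#|S|) : node := enum_val k.

Definition nbh (i : node) : {set node} := [set j | edge i j].

Definition ndim : nat := (\sum_(i < nnodes net) xdim i)%N.
Definition mdim : nat := (\sum_(k < #|S|) udim (actn k))%N.
Definition nbdim (i : node) : nat :=
  (\sum_(l < #|nbh i|) xdim (enum_val l : node))%N.

Definition xcomp (x : 'cV[R]_ndim) (i : node) : 'cV[R]_(xdim i) :=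
  submxcol x i.
Definition ucomp (u : 'cV[R]_mdim) (k : 'I_#|S|) : 'cV[R]_(udim (actn k)) :=
  submxcol u k.
Definition xnbh (x : 'cV[R]_ndim) (i : node) : 'cV[R]_(nbdim i) :=
  \mxcol_(l < #|nbh i|) xcomp x (enum_val l).

Definition Amx : 'M[R]_ndim :=
  \mxblock_(i < nnodes net, j < nnodes net)
    (if (j == i) || (j \in nbh i) then Aij i j else 0).

(* As in the library's mxdiag, conform_mx is the cast along the equality
   i = actn k. *)
Definition Bmx : 'M[R]_(ndim, mdim) :=
  \mxblock_(i < nnodes net, k < #|S|)
    (if i == actn k then conform_mx 0 (Bi (actn k)) else 0).

(* The three lemmas below recover the node dynamics from the compact form. *)
Lemma Amx_comp (x : 'cV[R]_ndim) (i : node) :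
  xcomp (Amx *m x) i =
    Aij i i *m xcomp x i + \sum_(j in nbh i) Aij i j *m xcomp x j.
Proof.
rewrite /xcomp -[x in LHS](submxcolK x) /Amx mul_mxblock_mxrow mxcolK.
rewrite (bigD1 i) //= eqxx; congr (_ + _).
rewrite [RHS]big_mkcond [LHS]big_mkcond /=; apply: eq_bigr => j _.
have [->|_] := eqVneq j i; first by rewrite inE edge_irr.
by rewrite /=; case: (j \in nbh i); rewrite ?mul0mx.
Qed.

Lemma Bmx_actn (u : 'cV[R]_mdim) (k : 'I_#|S|) :
  xcomp (Bmx *m u) (actn k) = Bi (actn k) *m ucomp u k.
Proof.
rewrite /xcomp -[u in LHS](submxcolK u) /Bmx mul_mxblock_mxrow mxcolK.
rewrite (bigD1 k) //= eqxx conform_mx_id big1 ?addr0 // => l lk.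
by rewrite /actn (inj_eq enum_val_inj) eq_sym (negbTE lk) mul0mx.
Qed.

Lemma Bmx_nact (u : 'cV[R]_mdim) (i : node) :
  i \notin S -> xcomp (Bmx *m u) i = 0.
Proof.
move=> iS; rewrite /xcomp -[u](submxcolK u) /Bmx mul_mxblock_mxrow mxcolK.
rewrite big1 // => k _; case: eqVneq => [ik|]; last by rewrite mul0mx.
by move: iS; rewrite ik enum_valP.
Qed.

Section Data.
Variables (Td Tini T : nat) (ud : signal R mdim) (xd : signal R ndim).

Definition tau : nat := (Tini + T + 1)%N.

Definition Hact (k : 'I_#|S|) :=
  col_mx (col_mx (hankel Td tau (fun t => ucomp (ud t) k))
                 (hankel Td tau (fun t => xnbh (xd t) (actn k))))
         (hankel Td tau (fun t => xcomp (xd t) (actn k))).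

Definition Hnact (i : node) :=
  col_mx (hankel Td tau (fun t => xnbh (xd t) i))
         (hankel Td tau (fun t => xcomp (xd t) i)).

Definition global_excitation : Prop :=
  persistently_exciting Td (ndim + tau) ud.

Definition local_excitation : Prop :=
  (forall k : 'I_#|S|,
     persistently_exciting Td (xdim (actn k) + tau)
       (fun t => col_mx (ucomp (ud t) k) (xnbh (xd t) (actn k)))) /\
  (forall i : node, i \notin S ->
     persistently_exciting Td (xdim i + tau) (fun t => xnbh (xd t) i)).

Variables (Q : forall i : node, 'M[R]_(xdim i))
          (Rw : forall i : node, 'M[R]_(udim i)).

Definition Jact (k : 'I_#|S|) (x : signal R ndim) (u : signal R mdim) : R :=
  \sum_(t < T) (wnorm (Q (actn k)) (xcomp (x t) (actn k)) ^+ 2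
                + wnorm (Rw (actn k)) (ucomp (u t) k) ^+ 2).

Definition Jnact (i : node) (x : signal R ndim) : R :=
  \sum_(t < T) wnorm (Q i) (xcomp (x t) i) ^+ 2.

Definition cost (u : signal R mdim) (x : signal R ndim) : R :=
  \sum_(k < #|S|) Jact k x u + \sum_(i in ~: S) Jnact i x.

Definition multipliers : Type := node -> 'cV[R]_(Td.+1 - tau).

(* The future samples of u and x run over [0, T]. *)
Definition feasible (uini : signal R mdim) (xini : signal R ndim)
    (g : multipliers) (u : signal R mdim) (x : signal R ndim) : Prop :=
  let uf := concat Tini uini u in
  let xf := concat Tini xini x in
  [/\ forall k : 'I_#|S|,
        Hact k *m g (actn k) =
        col_mx (col_mx (stackt tau (fun t => ucomp (uf t) k))
                       (stackt tau (fun t => xnbh (xf t) (actn k))))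
               (stackt tau (fun t => xcomp (xf t) (actn k))),
      forall i : node, i \notin S ->
        Hnact i *m g i =
        col_mx (stackt tau (fun t => xnbh (xf t) i))
               (stackt tau (fun t => xcomp (xf t) i))
    & forall i : node, xcomp (x T) i = 0].

Definition optimal (uini : signal R mdim) (xini : signal R ndim)
    (g : multipliers) (u : signal R mdim) (x : signal R ndim) : Prop :=
  feasible uini xini g u x /\
  forall g' u' x', feasible uini xini g' u' x' -> cost u x <= cost u' x'.

Definition next_state (uini : signal R mdim) (xini : signal R ndim)
    : 'cV[R]_ndim :=
  Amx *m xini Tini.-1 + Bmx *m uini Tini.-1.

(* v is an input that the algorithm may apply when the most recent inputs and
   states are uini, xini. Only the input part uhat of the approximate solution
   is constrained by the tolerance. *)
Definition algorithm_input (delta : R) (uini : signal R mdim)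
    (xini : signal R ndim) (v : 'cV[R]_mdim) : Prop :=
  if next_state uini xini == 0 then v = 0 else
  exists (gs : multipliers) (us : signal R mdim) (xs : signal R ndim)
         (uhat : signal R mdim),
    [/\ optimal uini xini gs us xs,
        enorm (stackt T (fun t => uhat t - us t))
          <= delta * Num.min 1 (enorm (xini Tini.-1))
      & v = uhat 0%N].

(* A feedback that depends on the current state only applies the same input
   for all the histories that lead to that state. *)
Definition algorithm_feedback (delta : R) (phi : 'cV[R]_ndim -> 'cV[R]_mdim)
    : Prop :=
  phi 0 = 0 /\
  forall uini xini, trajectory Amx Bmx Tini uini xini ->
    algorithm_input delta uini xini (phi (next_state uini xini)).

(* The first Tini samples are an arbitrary trajectory of the system; from then
   on the input is computed from the Tini preceding samples, and may depend on
   all of them. *)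
Definition algorithm_run (delta : R) (u : signal R mdim) (x : signal R ndim)
    : Prop :=
  (forall t, x t.+1 = Amx *m x t + Bmx *m u t) /\
  (forall t, algorithm_input delta (fun s => u (t + s)%N)
               (fun s => x (t + s)%N) (u (t + Tini)%N)).

(* The input applied at time Tini depends on x (Tini.-1) through the
   tolerance, so both x (Tini.-1) and x Tini are part of the initial
   condition. *)
Definition algorithm_runs_stable (delta : R) : Prop :=
  (forall eps : R, 0 < eps -> exists2 d : R, 0 < d &
     forall u x, algorithm_run delta u x ->
       enorm (x Tini.-1) < d -> enorm (x Tini) < d ->
       forall t, enorm (x (Tini + t)%N) < eps) /\
  (forall u x, algorithm_run delta u x ->
     enorm (x t) @[t --> \oo] --> (0 : R)).

End Data.
End Network.

Arguments feasible {R net} Td Tini T ud xd uini xini g u x.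

(* Main.v *)
Require Import Defs.
From HB Require Import structures.
From mathcomp Require Import all_boot all_order all_algebra.
From mathcomp Require Import all_classical all_reals all_analysis.
From mathcomp Require Import zify ring lra.

Set Implicit Arguments.
Unset Strict Implicit.
Unset Printing Implicit Defensive.

Import Order.TTheory GRing.Theory Num.Theory.
Import numFieldNormedType.Exports.

Local Open Scope classical_set_scope.
Local Open Scope ring_scope.

(** By Willems' fundamental lemma, applied to the whole network or to every node
    with the states of its neighbours as inputs, the constraints of (P) say
    exactly that the plan is a trajectory from the current state to the origin.
    Hence the exact algorithm is receding-horizon LQ control with a terminal
    constraint, a linear feedback with closed-loop matrix F and quadratic value V.

    Since Q is only semidefinite, V itself need not be positive definite. But V
    does not increase, because the shifted plan remains admissible, and if it
    stays constant for T steps then, by uniqueness of minimizers, every optimal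
    plan is the shift of the previous one, so that F^T x is the end point 0 of
    the first plan. Thus the quadratic form V - V o F^T dominates |F^T x|^2, and
    F is a contraction in a suitable norm.

    The inexact algorithm adds an error of at most delta times the norm of the
    previous state, which a small delta makes harmless. For a state feedback the
    previous state can be chosen as a linear function of the current one, since
    controllability makes [A B] surjective. *)

(** * The fundamental lemma *)

(** Cayley-Hamilton; the characteristic polynomial is monic, whence [c n = 1]. *)
Lemma annihilating_polynomial (R : comNzRingType) n (A : 'M[R]_n) :
  exists2 c : nat -> R, c n = 1 & \sum_(i < n.+1) c i *: A ^+ i = 0.
Proof.
exists (fun i => (char_poly A)`_i).
  have /monicP := char_poly_monic A.
  by rewrite /lead_coef size_char_poly.
case: n A => [|n] A; first by apply/matrixP => -[].
rewrite -[RHS](Cayley_Hamilton A) -[in RHS](coefK (char_poly A)) poly_def.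
rewrite size_char_poly linear_sum; apply: eq_bigr => i _.
by rewrite linearZ /= rmorphXn /= horner_mx_X.
Qed.

Lemma mxcol_mulrowE (R : pzRingType) p (p_ : 'I_p -> nat) k
    (v : 'rV[R]_(\sum_i p_ i)) (C : forall i, 'M[R]_(p_ i, k)) :
  v *m \mxcol_i C i = \sum_i submxrow v i *m C i.
Proof. by rewrite -[v in LHS]submxrowK mul_mxrow_mxcol. Qed.

Section FundamentalLemma.
Context {R : realType} {n m : nat} (A : 'M[R]_n) (B : 'M[R]_(n, m)).

(** Full row rank of the Hankel matrix means a trivial left kernel; [eta] lists the blocks of a row
    vector in that kernel. *)
Lemma excitation_left_kernel k Td L (w : signal R k) (eta : nat -> 'rV[R]_k) :
  persistently_exciting Td L w ->
  (forall b, (b < Td.+1 - L)%N -> \sum_(a < L) eta a *m w (a + b)%N = 0) ->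
  forall a, (a < L)%N -> eta a = 0.
Proof.
move=> pe eta0 a aL.
have /row_free_inj inj : row_free (hankel Td L w).
  by rewrite /row_free pe sum_nat_const card_ord mulnC.
have /inj : (\mxrow_(a < L) eta a) *m hankel Td L w = 0 *m hankel Td L w.
  rewrite mul0mx mul_mxrow_mxcol; apply/rowP => b; rewrite [RHS]mxE.
  have := eta0 b (ltn_ord b) => /rowP/(_ 0); rewrite [RHS]mxE => <-.
  rewrite !summxE; apply: eq_bigr => a' _; rewrite !mxE.
  by apply: eq_bigr => r _; rewrite !mxE.
by move=> /(congr1 (fun M => submxrow M (Ordinal aL))); rewrite mxrowK submxrow0.
Qed.

(** Along a trajectory from 0, every [xi *m A ^+ k] annihilates the state; all basis vectors are
    reached, so [xi] vanishes. *)
Lemma controllable_left_kernel (xi : 'rV[R]_n) :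
  controllable A B -> (forall k, xi *m A ^+ k *m B = 0) -> xi = 0.
Proof.
move=> ctrl xiAB; apply/rowP => j.
have [L [u [x [tr x0 xL]]]] := ctrl 0 (delta_mx j 0).
have xi0 t : (t <= L)%N -> forall k, xi *m A ^+ k *m x t = 0.
  elim: t => [|t IH] tL k; first by rewrite x0 mulmx0.
  rewrite tr ?ltnS // mulmxDr !mulmxA xiAB mul0mx addr0.
  by rewrite -(mulmxA xi) -[A ^+ k *m A]exprSr IH // ltnW.
have := xi0 L (leqnn L) 0%N; rewrite expr0 mulmx1 xL => /rowP/(_ 0).
by rewrite -colE !mxE.
Qed.

(* The functional (xi, eta) is propagated [i] steps backward along the data:
   its input part becomes the window of length [L + i] at the end of the
   sequence xi A^(n-1) B, ..., xi B, eta_0, ..., eta_(L-1).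
   Combining these relations with an annihilating polynomial of [A] eliminates
   the state, after which the excitation of order [n + L] kills the combination
   of the windows. *)
Lemma trajectory_left_kernel Td L (ud : signal R m) (xd : signal R n)
    (xi : 'rV[R]_n) (eta : nat -> 'rV[R]_m) :
  controllable A B -> (0 < L)%N -> trajectory A B Td ud xd ->
  persistently_exciting Td (n + L) ud ->
  (forall b, (b < Td.+1 - L)%N ->
     xi *m xd b + \sum_(a < L) eta a *m ud (a + b)%N = 0) ->
  xi = 0 /\ forall a, (a < L)%N -> eta a = 0.
Proof.
move=> ctrl L0 tr pe ker.
pose s j := if (j < n)%N then xi *m A ^+ (n.-1 - j) *m B
            else if (j < n + L)%N then eta (j - n)%N else 0.
have s_out j : (n + L <= j)%N -> s j = 0.
  move=> jn; rewrite /s ltnNge (leq_trans _ jn) ?leq_addr //=.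
  by rewrite ltnNge jn.
(* Inserting the dynamics into the relation at [b.+1] exposes [xi A^i B], the entry of [s] just
   before the window; the last entry of the old window has index at least [n + L] and drops out. *)
have rel i : (i <= n)%N -> forall b, (b + i < Td.+1 - L)%N ->
    xi *m A ^+ i *m xd b + \sum_(a < n + L) s (a + (n - i))%N *m ud (a + b)%N = 0.
  elim: i => [|i IH] i_n b bi.
    rewrite expr0 mulmx1 subn0 -[RHS](ker b); last by rewrite addn0 in bi.
    congr (_ + _); rewrite addnC big_split_ord /= [X in _ + X]big1 ?addr0;
      last by move=> a _; rewrite s_out ?mul0mx //; lia.
    apply: eq_bigr => a _; rewrite /s.
    rewrite ltnNge leq_addl /= addnC ltn_add2l ltn_ord.
    by rewrite addnC addnK.
  have := IH (ltnW i_n) b.+1; rewrite addSnnS => /(_ bi).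
  rewrite tr; last by lia.
  rewrite mulmxDr !mulmxA -(mulmxA xi) -[A ^+ i *m A]exprSr -addrA.
  move=> IHb; rewrite -[RHS]IHb; congr (_ + _).
  case: (n + L)%N {IH IHb tr ker pe bi} (s_out) (leq_trans i_n (leq_addr L n)) => [|N] s0 iN.
    by rewrite ltn0 in iN.
  rewrite big_ord_recl /= big_ord_recr /= [s (N + _)%N]s0; last by lia.
  rewrite mul0mx addr0; congr (_ + _).
    rewrite /s add0n; case: ifP; last by lia.
    by move=> _; congr (_ *m _ *m _ *m _); congr (_ ^+ _); lia.
  apply: eq_bigr => a _; rewrite /bump /= add1n addnS addSnnS.
  by congr (s _ *m _); lia.
have [c cn cA] := annihilating_polynomial A.
(* Weighting the relations by [c] cancels the state terms; all of them hold at the columns of the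
   Hankel matrix of order [n + L]. *)
have comb a : (a < n + L)%N -> \sum_(i < n.+1) c i *: s (a + (n - i))%N = 0.
  apply: (excitation_left_kernel pe (eta := fun a => \sum_(i < n.+1) c i *: s (a + (n - i))%N)).
  move=> b bT.
  transitivity (xi *m (\sum_(i < n.+1) c i *: A ^+ i) *m xd b +
    \sum_(a0 < n + L) (\sum_(i < n.+1) c i *: s (a0 + (n - i))%N) *m ud (a0 + b)%N).
    by rewrite cA mulmx0 mul0mx add0r.
  under [X in _ + X]eq_bigr do rewrite mulmx_suml.
  rewrite exchange_big mulmx_sumr mulmx_suml -big_split big1 // => i _ /=.
  rewrite -scalemxAr -scalemxAl.
  under eq_bigr do rewrite -scalemxAl.
  rewrite -scaler_sumr -scalerDr rel ?scaler0 //; have := ltn_ord i; lia.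
(* Downward induction: [s a] is the [i = n] term of [comb], and the other terms have larger
   indices. *)
have s0 a : s a = 0.
  have [k] := ubnP (n + L - a).
  elim: k a => // k IH a ak.
  have [aN|/s_out//] := ltnP a (n + L).
  have := comb a aN; rewrite big_ord_recr /= cn scale1r subnn addn0 big1 ?add0r //.
  move=> i _; rewrite IH ?scaler0 //; have := ltn_ord i; lia.
split; last first.
  move=> a aL; have := s0 (n + a)%N.
  by rewrite /s ltnNge leq_addr /= ltn_add2l aL addKn.
apply: controllable_left_kernel ctrl _ => k.
(* For [k < n] this is an entry of [s]; higher powers reduce by the annihilating polynomial. *)
elim/ltn_ind: k => k IH.
have [kn|nk] := ltnP k n.
  have := s0 (n.-1 - k)%N; rewrite /s; case: ifP; last by lia.
  by move=> _; have -> : (n.-1 - (n.-1 - k) = k)%N by lia.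
have An : A ^+ n = - \sum_(i < n) c i *: A ^+ i.
  move: cA; rewrite big_ord_recr /= cn scale1r => /eqP.
  by rewrite addrC addr_eq0 => /eqP.
rewrite -(subnKC nk) exprD An mulNr mulmxN mulNmx.
rewrite [_ * _]mulmx_suml mulmx_sumr mulmx_suml big1 ?oppr0 // => i _.
rewrite -scalemxAl -scalemxAr -scalemxAl [_ *m A ^+ _](esym (exprD _ _ _)).
by rewrite IH ?scaler0 //; have := ltn_ord i; lia.
Qed.

(** A Hankel matrix times [g], read as a signal: a superposition of shifted copies of [w]. *)
Definition combination k N (g : 'cV[R]_N) (w : signal R k) : signal R k :=
  fun a => \sum_(b < N) g b 0 *: w (a + b)%N.

Lemma hankel_mulP k Td L (w v : signal R k) (g : 'cV[R]_(Td.+1 - L)) :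
  hankel Td L w *m g = stackt L v <->
  forall a, (a < L)%N -> combination g w a = v a.
Proof.
have E (a : 'I_L) :
    submxcol (hankel Td L w *m g) a = combination g w a.
  rewrite -submxcol_mul /hankel mxcolK; apply/colP => r; rewrite mxE summxE.
  by apply: eq_bigr => b _; rewrite !mxE mulrC.
split=> [H a aL|H].
  have := E (Ordinal aL); rewrite H /stackt mxcolK /= => ->//.
by apply/mxcolP => a; rewrite E /stackt mxcolK H.
Qed.

Lemma combination_linear k l N (g : 'cV[R]_N) (f : 'cV[R]_k -> 'cV[R]_l)
    (w : signal R k) a :
  linear f -> combination g (fun t => f (w t)) a = f (combination g w a).
Proof.
move=> flin; pose F : {linear _ -> _} :=
  HB.pack f (GRing.isLinear.Build R _ _ *:%R f flin).
rewrite -[f]/(F : _ -> _) /combination linear_sum.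
by apply: eq_bigr => b _; rewrite linearZ.
Qed.

Lemma combination_col_mx k l N (g : 'cV[R]_N) (v : signal R k) (w : signal R l) a :
  combination g (fun t => col_mx (v t) (w t)) a =
  col_mx (combination g v a) (combination g w a).
Proof.
rewrite /combination; elim/big_rec3: _ => [|b x y z _ ->]; first by rewrite col_mx0.
by rewrite scale_col_mx add_col_mx.
Qed.

(** Time shifts of the data solve the same linear dynamics, and windows of length [L] stay inside
    the data. *)
Lemma combination_trajectory Td L (ud : signal R m) (xd : signal R n)
    (g : 'cV[R]_(Td.+1 - L)) :
  trajectory A B Td ud xd ->
  trajectory A B L (combination g ud) (combination g xd).
Proof.
move=> tr t tL; rewrite /combination !mulmx_sumr -big_split.
apply: eq_bigr => b _; rewrite addSn tr; last by have := ltn_ord b; lia.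
by rewrite scalerDr -!scalemxAr.
Qed.

Lemma trajectory_unique L (u v : signal R m) (x y : signal R n) :
  trajectory A B L u x -> trajectory A B L v y ->
  x 0%N = y 0%N -> (forall t, (t < L)%N -> u t = v t) ->
  forall t, (t < L)%N -> x t = y t.
Proof.
move=> trx try_ xy0 uv; elim=> [//|t IH] tL.
by rewrite trx // try_ // IH ?uv // ltnW.
Qed.

(** The initial states of the windows, stacked on the input Hankel matrix, have full row rank, so
    some [g] reproduces [x 0] and [u]; these determine the remaining states. *)
Lemma fundamental_lemma Td L (ud u : signal R m) (xd x : signal R n) :
  controllable A B -> (0 < L)%N -> trajectory A B Td ud xd ->
  persistently_exciting Td (n + L) ud -> trajectory A B L u x ->
  exists g : 'cV[R]_(Td.+1 - L), forall a, (a < L)%N ->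
    combination g ud a = u a /\ combination g xd a = x a.
Proof.
move=> ctrl L0 trd pe tr.
pose X := \matrix_(r < n, b < Td.+1 - L) xd b r 0.
have : row_free (col_mx X (hankel Td L ud)).
  apply: inj_row_free => v; rewrite -[v]hsubmxK; move: (lsubmx v) (rsubmx v).
  move=> xi eta; rewrite mul_row_col mxcol_mulrowE => H.
  pose eta' a := if insub a is Some i then submxrow eta (i : 'I_L) else 0.
  have [|xi0 eta0] := @trajectory_left_kernel Td L ud xd xi eta' ctrl L0 trd pe.
    move=> b bT; move/rowP/(_ (Ordinal bT)): H; rewrite [RHS]mxE mxE => H.
    apply/rowP => j; rewrite (ord1 j) [RHS]mxE -[RHS]H mxE; congr (_ + _).
      by rewrite !mxE; apply: eq_bigr => r _; rewrite !mxE.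
    rewrite !summxE; apply: eq_bigr => a _; rewrite /eta' valK !mxE.
    by apply: eq_bigr => r _; rewrite !mxE.
  rewrite xi0; suff -> : eta = 0 by rewrite row_mx0.
  apply/mxrowP => a; rewrite submxrow0.
  by have := eta0 a (ltn_ord a); rewrite /eta' valK.
move=> /row_freeP [G HG].
exists (G *m col_mx (x 0%N) (stackt L u)) => a aL.
set g := G *m _.
have : col_mx X (hankel Td L ud) *m g = col_mx (x 0%N) (stackt L u).
  by rewrite mulmxA HG mul1mx.
rewrite mul_col_mx => /eq_col_mx [Xg /hankel_mulP Hg].
split; first exact: Hg.
apply: (trajectory_unique (combination_trajectory g trd) tr) => //.
rewrite -Xg; apply/colP => r; rewrite mxE summxE.
by apply: eq_bigr => b _; rewrite !mxE add0n mulrC.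
Qed.

End FundamentalLemma.

(** * Feasible plans of the network *)

Section NetworkData.
Context {R : realType} (net : network R).

Local Notation node := 'I_(nnodes net).
Local Notation S := (act net).
Local Notation A := (Amx net).
Local Notation B := (Bmx net).

Lemma actnP (i : node) : i \in S -> exists k : 'I_#|S|, i = actn k.
Proof. by move=> iS; exists (enum_rank_in iS i); rewrite /actn enum_rankK_in. Qed.

Lemma submxcol_linear p (p_ : 'I_p -> nat) (i : 'I_p) :
  linear (fun v : 'cV[R]_(\sum_i p_ i) => submxcol v i).
Proof. by move=> a u v; apply/colP => j; rewrite !mxE. Qed.

Lemma xcomp_linear (i : node) : linear (fun x : 'cV[R]_(ndim net) => xcomp x i).
Proof. exact: submxcol_linear. Qed.

Lemma ucomp_linear (k : 'I_#|S|) :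
  linear (fun u : 'cV[R]_(mdim net) => ucomp u k).
Proof. exact: submxcol_linear. Qed.

Lemma xnbh_linear (i : node) : linear (fun x : 'cV[R]_(ndim net) => xnbh x i).
Proof.
move=> a u v; apply/mxcolP => l.
by rewrite submxcol_linear !mxcolK xcomp_linear.
Qed.

(** Seen from node [i], the states of the neighbours act as an external input; this is their input
    matrix. *)
Definition nbh_input_mx (i : node) : 'M[R]_(xdim i, nbdim i) :=
  \mxrow_(l < #|nbh i|) Aij i (enum_val l).

Lemma nbh_input_mulmx (x : 'cV[R]_(ndim net)) (i : node) :
  nbh_input_mx i *m xnbh x i = \sum_(j in nbh i) Aij i j *m xcomp x j.
Proof.
by rewrite mul_mxrow_mxcol (big_enum_val (fun j => Aij i j *m xcomp x j)).
Qed.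

Definition actn_input_mx (k : 'I_#|S|) :=
  row_mx (Bi (actn k)) (nbh_input_mx (actn k)).

Definition actn_input (k : 'I_#|S|) (u : signal R (mdim net))
    (x : signal R (ndim net)) : signal R _ :=
  fun t => col_mx (ucomp (u t) k) (xnbh (x t) (actn k)).

Lemma xcomp_next_actn (k : 'I_#|S|) x u :
  xcomp (A *m x + B *m u) (actn k) =
  Aij (actn k) (actn k) *m xcomp x (actn k) +
  actn_input_mx k *m col_mx (ucomp u k) (xnbh x (actn k)).
Proof.
rewrite -[X in X + _]scale1r xcomp_linear scale1r Amx_comp Bmx_actn mul_row_col.
by rewrite nbh_input_mulmx -addrA [X in _ + X]addrC.
Qed.

Lemma xcomp_next_nact (i : node) x u : i \notin S ->
  xcomp (A *m x + B *m u) i =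
  Aij i i *m xcomp x i + nbh_input_mx i *m xnbh x i.
Proof.
move=> iS; rewrite -[X in X + _]scale1r xcomp_linear scale1r Amx_comp.
by rewrite Bmx_nact // nbh_input_mulmx addr0.
Qed.

Lemma trajectory_actn L u x (k : 'I_#|S|) : trajectory A B L u x ->
  trajectory (Aij (actn k) (actn k)) (actn_input_mx k) L
    (actn_input k u x) (fun t => xcomp (x t) (actn k)).
Proof. by move=> tr t tL; rewrite tr // xcomp_next_actn. Qed.

Lemma trajectory_nact L u x (i : node) : i \notin S -> trajectory A B L u x ->
  trajectory (Aij i i) (nbh_input_mx i) L
    (fun t => xnbh (x t) i) (fun t => xcomp (x t) i).
Proof. by move=> iS tr t tL; rewrite tr // xcomp_next_nact. Qed.

Lemma xcomp_surj (i : node) (v : 'cV[R]_(xdim i)) :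
  exists x : 'cV[R]_(ndim net), xcomp x i = v.
Proof.
exists (\mxcol_j conform_mx (0 : 'cV[R]_(xdim j)) v).
by rewrite /xcomp mxcolK conform_mx_id.
Qed.

(** A network trajectory between states that extend the prescribed end points projects to the
    node. *)
Lemma controllable_actn (k : 'I_#|S|) : controllable A B ->
  controllable (Aij (actn k) (actn k)) (actn_input_mx k).
Proof.
move=> ctrl v0 v1; have [x0 <-] := xcomp_surj v0; have [x1 <-] := xcomp_surj v1.
have [L [u [x [tr <- <-]]]] := ctrl x0 x1.
by do 3 eexists; split; first exact: trajectory_actn tr.
Qed.

Lemma controllable_nact (i : node) : i \notin S -> controllable A B ->
  controllable (Aij i i) (nbh_input_mx i).
Proof.
move=> iS ctrl v0 v1; have [x0 <-] := xcomp_surj v0; have [x1 <-] := xcomp_surj v1.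
have [L [u [x [tr <- <-]]]] := ctrl x0 x1.
by do 3 eexists; split; first exact: trajectory_nact iS tr.
Qed.

Variables (Td Tini T : nat) (ud : signal R (mdim net)) (xd : signal R (ndim net)).
Local Notation tau := (tau Tini T).

Lemma Hact_mulP (k : 'I_#|S|) g u x :
  Hact Td Tini T ud xd k *m g =
  col_mx (col_mx (stackt tau (fun t => ucomp (u t) k))
                 (stackt tau (fun t => xnbh (x t) (actn k))))
         (stackt tau (fun t => xcomp (x t) (actn k))) <->
  forall a, (a < tau)%N ->
    combination g (actn_input k ud xd) a = actn_input k u x a /\
    combination g (fun t => xcomp (xd t) (actn k)) a = xcomp (x a) (actn k).
Proof.
rewrite /Hact !mul_col_mx; split.
  move=> /eq_col_mx [/eq_col_mx [/hankel_mulP Hu /hankel_mulP Hn] /hankel_mulP Hx].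
  by move=> a aL; rewrite combination_col_mx Hu ?Hn ?Hx.
by move=> H; congr (col_mx (col_mx _ _) _); apply/hankel_mulP => a aL;
  have [] := H a aL; rewrite combination_col_mx => /eq_col_mx [].
Qed.

Lemma Hnact_mulP (i : node) g x :
  Hnact Td Tini T xd i *m g =
  col_mx (stackt tau (fun t => xnbh (x t) i))
         (stackt tau (fun t => xcomp (x t) i)) <->
  forall a, (a < tau)%N ->
    combination g (fun t => xnbh (xd t) i) a = xnbh (x a) i /\
    combination g (fun t => xcomp (xd t) i) a = xcomp (x a) i.
Proof.
rewrite /Hnact !mul_col_mx; split.
  by move=> /eq_col_mx [/hankel_mulP Hn /hankel_mulP Hx] a aL; rewrite Hn ?Hx.
by move=> H; congr (col_mx _ _); apply/hankel_mulP => a aL; have [] := H a aL.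
Qed.

(** Each node's equation yields a combination of data windows, which obeys the dynamics of that
    node. The multipliers differ between nodes, but the plan is shared, so the node dynamics
    assemble into the compact form. *)
Lemma feasible_trajectory uini xini g u x : trajectory A B Td ud xd ->
  feasible Td Tini T ud xd uini xini g u x ->
  trajectory A B tau (concat Tini uini u) (concat Tini xini x) /\ x T = 0.
Proof.
move=> data [Ha Hn xT]; split; last first.
  by apply/mxcolP => i; rewrite submxcol0 -(xT i).
move=> t tL; apply/mxcolP => i; change (submxcol ?v i) with (xcomp v i).
have [/actnP [k ->]|iS] := boolP (i \in S).
  have /Hact_mulP H := Ha k.
  rewrite xcomp_next_actn -(H _ tL).2.
  rewrite (combination_trajectory _ (trajectory_actn k data)) //.
  by rewrite (H _ (ltnW tL)).1 (H _ (ltnW tL)).2.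
have /Hnact_mulP H := Hn i iS.
rewrite xcomp_next_nact // -(H _ tL).2.
rewrite (combination_trajectory _ (trajectory_nact iS data)) //.
by rewrite (H _ (ltnW tL)).1 (H _ (ltnW tL)).2.
Qed.

(** Under global excitation one [g] serves all nodes; under local excitation the fundamental lemma
    applies to each node as a system driven by its neighbours. *)
Lemma trajectory_feasible uini xini u x :
  controllable A B -> trajectory A B Td ud xd ->
  global_excitation Td Tini T ud \/ local_excitation Td Tini T ud xd ->
  trajectory A B tau (concat Tini uini u) (concat Tini xini x) -> x T = 0 ->
  exists g, feasible Td Tini T ud xd uini xini g u x.
Proof.
move=> ctrl data exc tr xT.
have tau0 : (0 < tau)%N by rewrite /Defs.tau addn1.
have xT0 i : xcomp (x T) i = 0 by rewrite xT /xcomp submxcol0.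
case: exc => [pe|[pea pen]].
  have [g Hg] := fundamental_lemma ctrl tau0 data pe tr.
  exists (fun=> g); split=> // [k|i iS].
    apply/Hact_mulP => a aL; have [Hu Hx] := Hg a aL; split; last first.
      by rewrite (combination_linear _ _ _ (@xcomp_linear _)) Hx.
    rewrite combination_col_mx (combination_linear _ _ _ (@ucomp_linear _)).
    by rewrite (combination_linear _ _ _ (@xnbh_linear _)) Hu Hx.
  apply/Hnact_mulP => a aL; have [Hu Hx] := Hg a aL.
  rewrite (combination_linear _ _ _ (@xcomp_linear _)).
  by rewrite (combination_linear _ _ _ (@xnbh_linear _)) Hx.
(* Both kinds of node are bundled in one statement so that [choice] yields a single family of
   multipliers. *)
have H i : exists g : 'cV[R]_(Td.+1 - tau),
  (forall k, i = actn k -> Hact Td Tini T ud xd k *m g =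
        col_mx (col_mx (stackt tau (fun t => ucomp (concat Tini uini u t) k))
                       (stackt tau (fun t => xnbh (concat Tini xini x t) (actn k))))
               (stackt tau (fun t => xcomp (concat Tini xini x t) (actn k)))) /\
  (i \notin S -> Hnact Td Tini T xd i *m g =
        col_mx (stackt tau (fun t => xnbh (concat Tini xini x t) i))
               (stackt tau (fun t => xcomp (concat Tini xini x t) i))).
  have [/[dup] iS /actnP [k ik]|iS] := boolP (i \in S).
    have [g Hg] := fundamental_lemma (controllable_actn ctrl) tau0
      (trajectory_actn k data) (pea k) (trajectory_actn k tr).
    exists g; split=> // k'; rewrite ik => /enum_val_inj <-.
    exact/Hact_mulP.
  have [g Hg] := fundamental_lemma (controllable_nact iS ctrl) tau0
      (trajectory_nact iS data) (pen i iS) (trajectory_nact iS tr).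
  exists g; split=> [k ik|_]; first by rewrite ik enum_valP in iS.
  exact/Hnact_mulP.
have [g Hg] := choice H.
exists g; split=> // [k|i]; first exact: (Hg (actn k)).1.
exact: (Hg i).2.
Qed.

End NetworkData.

(** * Receding-horizon linear-quadratic control *)

Section QuadraticForms.
Context {R : realType}.

Definition bform {k l} (M : 'M[R]_(k, l)) (u : 'cV[R]_k) (v : 'cV[R]_l) : R :=
  (u^T *m M *m v) 0 0.

Lemma bformDl k l (M : 'M[R]_(k, l)) u u' v :
  bform M (u + u') v = bform M u v + bform M u' v.
Proof. by rewrite /bform linearD !mulmxDl mxE. Qed.

Lemma bformDr k l (M : 'M[R]_(k, l)) u v v' :
  bform M u (v + v') = bform M u v + bform M u v'.
Proof. by rewrite /bform mulmxDr mxE. Qed.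

Lemma bformZl k l (M : 'M[R]_(k, l)) a u v : bform M (a *: u) v = a * bform M u v.
Proof. by rewrite /bform linearZ -!scalemxAl mxE. Qed.

Lemma bformZr k l (M : 'M[R]_(k, l)) a u v : bform M u (a *: v) = a * bform M u v.
Proof. by rewrite /bform -scalemxAr mxE. Qed.

Lemma bform0r k l (M : 'M[R]_(k, l)) u : bform M u 0 = 0.
Proof. by rewrite /bform mulmx0 mxE. Qed.

Lemma bformC k (M : 'M[R]_k) u v : M^T = M -> bform M u v = bform M v u.
Proof.
move=> Ms; rewrite /bform -[u^T *m M *m v]trmxK [LHS]mxE !trmx_mul trmxK Ms.
by rewrite mulmxA.
Qed.

Lemma bform_mulmx k l k' l' (M : 'M[R]_(k, l)) (X : 'M[R]_(k, k')) (Y : 'M[R]_(l, l')) u v :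
  bform M (X *m u) (Y *m v) = bform (X^T *m M *m Y) u v.
Proof. by rewrite /bform trmx_mul !mulmxA. Qed.

Definition sqn {k} (v : 'cV[R]_k) : R := \sum_i v i 0 ^+ 2.

Lemma sqnE k (v : 'cV[R]_k) : sqn v = (v^T *m v) 0 0.
Proof. by rewrite mxE; apply: eq_bigr => i _; rewrite mxE expr2. Qed.

Lemma sqn_ge0 k (v : 'cV[R]_k) : 0 <= sqn v.
Proof. by apply: sumr_ge0 => i _; rewrite sqr_ge0. Qed.

Lemma sqr_le_sqn k (v : 'cV[R]_k) i : v i 0 ^+ 2 <= sqn v.
Proof.
by rewrite /sqn (bigD1 i) //= lerDl; apply: sumr_ge0 => j _; rewrite sqr_ge0.
Qed.

Lemma bform_le_sqn k (M : 'M[R]_k) :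
  exists2 c, 0 < c & forall v, bform M v v <= c * sqn v.
Proof.
exists (1 + \sum_j \sum_i `|M i j|).
  by apply: ltr_pwDl => //; apply: sumr_ge0 => j _; apply: sumr_ge0.
move=> v; rewrite mulrDl mul1r; apply: (@le_trans _ _ ((\sum_j \sum_i `|M i j|) * sqn v)).
  rewrite /bform mxE mulr_suml; apply: ler_sum => j _.
  rewrite mxE !mulr_suml; apply: ler_sum => i _; rewrite mxE.
  have := sqr_le_sqn v i; have := sqr_le_sqn v j.
  have : M i j <= `|M i j| by exact: ler_norm.
  have : - M i j <= `|M i j| by rewrite lerNl; exact: lerNnormlW.
  move: (v i 0) (v j 0) (sqn v) (M i j) (`|M i j|) => x y s m a ma1 ma2 ys xs.
  (* [h1] and [h2] add up to [m x y <= a (x^2 + y^2) / 2]; [h3] and [h4] bound the squares by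
     [s]. *)
  have h1 : 0 <= (a - m) * (x + y) ^+ 2 by rewrite mulr_ge0 ?sqr_ge0 ?subr_ge0.
  have h2 : 0 <= (a + m) * (x - y) ^+ 2.
    by rewrite mulr_ge0 ?sqr_ge0 //; lra.
  have h3 : 0 <= a * (s - x ^+ 2) by rewrite mulr_ge0 ?subr_ge0 //; lra.
  have h4 : 0 <= a * (s - y ^+ 2) by rewrite mulr_ge0 ?subr_ge0 //; lra.
  nra.
by rewrite lerDr sqn_ge0.
Qed.

(* Cauchy-Schwarz for the form of [D], obtained from its value at v - D v / c. *)
Lemma psd_sqn_mulmx k (D : 'M[R]_k) : psd D ->
  exists2 c, 0 < c & forall v, sqn (D *m v) <= c * bform D v v.
Proof.
move=> [Ds D0]; have [c c0 Hc] := bform_le_sqn D; exists c => // v.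
have := D0 (v + (- c^-1) *: (D *m v)); rewrite -/(bform _ _ _).
rewrite bformDl !bformDr !bformZl !bformZr (bformC (D *m v) v Ds).
have -> : bform D v (D *m v) = sqn (D *m v).
  by rewrite /bform sqnE trmx_mul Ds.
have := Hc (D *m v); move: (sqn (D *m v)) (bform D v v) (bform D _ _) => s q b bs.
move=> H; have h : c^-1 * (c^-1 * b) <= c^-1 * s.
  by rewrite ler_pM2l ?invr_gt0 // mulrC ler_pdivrMr // mulrC.
have : 0 <= q - c^-1 * s by nra.
by rewrite subr_ge0 mulrC ler_pdivrMr // mulrC.
Qed.

(** [G] vanishes on the kernel of [D], hence factors as [L *m D], and the bound on [D *m v]
    applies. *)
Lemma psd_dominates k l (D : 'M[R]_k) (G : 'M[R]_(l, k)) : psd D ->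
  (forall v, bform D v v = 0 -> G *m v = 0) ->
  exists2 c, 0 < c & forall v, sqn (G *m v) <= c * bform D v v.
Proof.
move=> pD ker; have /submxP [L ->] : (G <= D)%MS.
  rewrite submxE; apply/eqP/matrixP => i j.
  have : G *m col j (cokermx D) = 0.
    by apply: ker; rewrite /bform -mulmxA colE [D *m _]mulmxA mulmx_coker
      mul0mx mulmx0 mxE.
  by rewrite colE mulmxA -colE => /colP/(_ i); rewrite !mxE.
have [c c0 Hc] := psd_sqn_mulmx pD; have [d d0 Hd] := bform_le_sqn (L^T *m L).
exists (d * c) => [|v]; first exact: mulr_gt0.
rewrite -mulmxA; apply: (@le_trans _ _ (d * sqn (D *m v))).
  by have := Hd (D *m v); rewrite /bform; move: (D *m v) => w;
    rewrite [sqn (L *m _)]sqnE trmx_mul !mulmxA.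
by rewrite -mulrA ler_pM2l.
Qed.

(* Pythagoras around the minimizer [S *m x] of the form of [M] subject to
   [C *m z = 0] and [X *m z = x]. *)
Lemma constrained_minimizer N n k (M : 'M[R]_N) (X : 'M[R]_(n, N))
    (C : 'M[R]_(k, N)) : psd M ->
  (forall x, exists z : 'cV_N, C *m z = 0 /\ X *m z = x) ->
  (forall z : 'cV_N, C *m z = 0 -> X *m z = 0 -> bform M z z <= 0 -> z = 0) ->
  exists S : 'M[R]_(N, n), [/\ C *m S = 0, X *m S = 1%:M &
    forall z : 'cV_N, C *m z = 0 ->
      bform M z z = bform M (S *m (X *m z)) (S *m (X *m z)) +
                    bform M (z - S *m (X *m z)) (z - S *m (X *m z))].
Proof.
move=> [Ms M0] surj pos.
(* The rows of [K] form a basis of the directions killed by both [C] and [X]. *)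
pose K := row_base (kermx (col_mx C X)^T).
have KP (z : 'cV_N) : C *m z = 0 -> X *m z = 0 -> exists y, z = K^T *m y.
  move=> Cz Xz; have /submxP [y yE] : (z^T <= K)%MS.
    by rewrite eq_row_base; apply/sub_kermxP; rewrite -trmx_mul mul_col_mx Cz Xz
      col_mx0 trmx0.
  by exists y^T; rewrite -trmx_mul -yE trmxK.
have [CK XK] : C *m K^T = 0 /\ X *m K^T = 0.
  have /sub_kermxP : (K <= kermx (col_mx C X)^T)%MS by rewrite eq_row_base.
  move=> /(congr1 trmx); rewrite trmx_mul trmxK mul_col_mx trmx0 => H.
  by apply/eq_col_mx; rewrite H col_mx0.
(* The form restricted to these directions, nondegenerate by [pos]. *)
pose H := K *m M *m K^T.
have uH : H \in unitmx.
  rewrite -row_free_unit; apply: inj_row_free => v vH.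
  suff : v *m K = 0 *m K by move/(row_free_inj (row_base_free _)).
  rewrite mul0mx; apply: (can_inj (@trmxK _ _ _)); rewrite trmx0.
  rewrite (trmx_mul v); apply: pos; rewrite ?mulmxA ?CK ?XK ?mul0mx //.
  have -> : bform M (K^T *m v^T) (K^T *m v^T) = (v *m H *m v^T) 0 0.
    by rewrite /bform (trmx_mul K^T) !trmxK /H !mulmxA.
  by rewrite vH mul0mx mxE.
have [S0 S0P] : exists S0 : 'M[R]_(N, n), C *m S0 = 0 /\ X *m S0 = 1%:M.
  have [f fP] := choice surj.
  exists (\matrix_(i, j) f (delta_mx j 0) i 0).
  have colf j : col j (\matrix_(i, j) f (delta_mx j 0) i 0) = f (delta_mx j 0).
    by apply/colP => i; rewrite !mxE.
  split; apply/matrixP => i j.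
    have [/colP/(_ i) + _] := fP (delta_mx j 0).
    by rewrite -colf colE mulmxA -colE !mxE.
  have [_ /colP/(_ i)] := fP (delta_mx j 0).
  by rewrite -colf colE mulmxA -colE !mxE eqxx andbT.
(* The section [S0] is corrected along these directions until its range is [M]-orthogonal to
   them. *)
pose S := S0 - K^T *m (invmx H *m (K *m M *m S0)).
have CS : C *m S = 0 by rewrite mulmxBr mulmxA CK S0P.1 mul0mx subr0.
have XS : X *m S = 1%:M by rewrite mulmxBr mulmxA XK S0P.2 mul0mx subr0.
have KMS : K *m M *m S = 0.
  by rewrite mulmxBr !mulmxA -/H mulmxV // mul1mx subrr.
exists S; split=> // z Cz; set x := X *m z.
have [y yE] : exists y, z - S *m x = K^T *m y.
  by apply: KP; rewrite mulmxBr mulmxA ?CS ?XS ?Cz ?mul0mx ?mul1mx subrr.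
have orth : bform M (K^T *m y) (S *m x) = 0.
  by rewrite bform_mulmx trmxK KMS /bform mulmx0 mul0mx mxE.
rewrite -{1 2}(subrK (S *m x) z) yE bformDl !bformDr [bform M (S *m x) (K^T *m _)]bformC //.
by rewrite orth addr0 add0r addrC.
Qed.

End QuadraticForms.

(** * Finite-horizon optimal plans *)

Section LinearQuadratic.
Context {R : realType} {n m : nat} (A : 'M[R]_n) (B : 'M[R]_(n, m)).
Variables (Q : 'M[R]_n) (Rw : 'M[R]_m) (T : nat).
Hypotheses (Q_psd : psd Q) (Rw_posdef : posdef Rw).

Local Notation plan := 'cV[R]_(n + \sum_(a < T) m).

(* A plan stacks an initial state and an input sequence on [0, T-1]; it is
   mapped by [plan_input t] and [plan_state t] to the input and the state at
   time [t]. The input is [0] from time [T] on. *)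
Definition plan_input t : 'M[R]_(m, n + \sum_(a < T) m) :=
  row_mx 0 (\mxrow_(a < T) if a == t :> nat then 1%:M else 0).

Fixpoint plan_state t : 'M[R]_(n, n + \sum_(a < T) m) :=
  if t is s.+1 then A *m plan_state s + B *m plan_input s else row_mx 1%:M 0.

Definition plan_of (x : 'cV[R]_n) (u : signal R m) : plan := col_mx x (stackt T u).

Definition plan_cost : 'M[R]_(n + \sum_(a < T) m) :=
  \sum_(t < T) ((plan_state t)^T *m Q *m plan_state t +
                (plan_input t)^T *m Rw *m plan_input t).

Definition stage_cost (x : 'cV[R]_n) (u : 'cV[R]_m) : R :=
  bform Q x x + bform Rw u u.

Lemma plan_input_of x u t : (t < T)%N -> plan_input t *m plan_of x u = u t.
Proof.
move=> tT; rewrite mul_row_col mul0mx add0r mul_mxrow_mxcol.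
rewrite (bigD1 (Ordinal tT)) //= eqxx mul1mx big1 ?addr0 // => a.
by rewrite -val_eqE /= => /negPf ->; rewrite mul0mx.
Qed.

Lemma plan_input_end : plan_input T = 0.
Proof.
rewrite /plan_input -[RHS]row_mx0; congr row_mx.
by apply/mxrowP => a; rewrite mxrowK submxrow0 ltn_eqF.
Qed.

Lemma plan_state0_of x u : plan_state 0 *m plan_of x u = x.
Proof. by rewrite /= mul_row_col mul1mx mul0mx addr0. Qed.

Lemma plan_stateS t (z : plan) :
  plan_state t.+1 *m z = A *m (plan_state t *m z) + B *m (plan_input t *m z).
Proof. by rewrite /= mulmxDl !mulmxA. Qed.

Lemma plan_state_of u x t : trajectory A B T.+1 u x -> (t <= T)%N ->
  plan_state t *m plan_of (x 0%N) u = x t.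
Proof.
move=> tr; elim: t => [|t IH] tT; first exact: plan_state0_of.
by rewrite plan_stateS IH ?plan_input_of ?tr // ltnW.
Qed.

Lemma plan_trajectory (z : plan) : trajectory A B T.+1
  (fun t => plan_input t *m z) (fun t => plan_state t *m z).
Proof. by move=> t _; rewrite plan_stateS. Qed.

Lemma plan_ext (z z' : plan) :
  plan_state 0 *m z = plan_state 0 *m z' ->
  (forall t, (t < T)%N -> plan_input t *m z = plan_input t *m z') -> z = z'.
Proof.
suff E (z1 : plan) : z1 = plan_of (plan_state 0 *m z1) (fun t => plan_input t *m z1).
  move=> x0 u; rewrite (E z) (E z') x0; congr col_mx.
  by apply/mxcolP => a; rewrite !mxcolK u.
rewrite -[LHS]vsubmxK; congr col_mx.
  by rewrite /= -[z1 in RHS]vsubmxK mul_row_col mul1mx mul0mx addr0.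
apply/mxcolP => a; rewrite mxcolK.
pose v s := if insub s is Some i then submxcol (dsubmx z1) (i : 'I_T) else 0.
have := plan_input_of (usubmx z1) v (ltn_ord a); rewrite {2}/v valK => <-.
congr (_ *m _); rewrite -[RHS]vsubmxK; congr col_mx.
by apply/mxcolP => b; rewrite mxcolK /v valK.
Qed.

Lemma bform_plan_cost (z : plan) : bform plan_cost z z =
  \sum_(t < T) stage_cost (plan_state t *m z) (plan_input t *m z).
Proof.
rewrite /bform /plan_cost mulmx_sumr mulmx_suml summxE; apply: eq_bigr => t _.
by rewrite /stage_cost !bform_mulmx /bform mulmxDr mulmxDl mxE.
Qed.

Lemma Rw_psd : psd Rw.
Proof.
split=> [|u]; first exact: Rw_posdef.1.
have [->|/Rw_posdef.2/ltW//] := eqVneq u 0; by rewrite mulmx0 mxE.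
Qed.

Lemma stage_cost_ge0 x u : 0 <= stage_cost x u.
Proof. by rewrite addr_ge0 //; [exact: Q_psd.2|exact: Rw_psd.2]. Qed.

Lemma plan_cost_psd : psd plan_cost.
Proof.
split=> [|z]; last by rewrite -/(bform _ _ _) bform_plan_cost sumr_ge0 // => t _;
  exact: stage_cost_ge0.
rewrite /plan_cost linear_sum; apply: eq_bigr => t _.
by rewrite linearD /= !trmx_mul !trmxK Q_psd.1 Rw_posdef.1 !mulmxA.
Qed.

(** Zero cost forces all inputs to vanish because [Rw] is positive definite. This makes minimizers
    unique even though [Q] is only semidefinite. *)
Lemma plan_cost_eq0 (z : plan) :
  plan_state 0 *m z = 0 -> bform plan_cost z z <= 0 -> z = 0.
Proof.
move=> z0 cz; apply: plan_ext; rewrite ?mulmx0 // => t tT; rewrite mulmx0.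
have c0 : \sum_(s < T) stage_cost (plan_state s *m z) (plan_input s *m z) = 0.
  apply/eqP; rewrite eq_le -bform_plan_cost cz bform_plan_cost sumr_ge0 // => s _.
  exact: stage_cost_ge0.
have := psumr_eq0P (fun s _ => stage_cost_ge0 _ _) c0.
move=> /(_ (Ordinal tT) isT) /= st0; apply: contraTeq isT => /Rw_posdef.2.
rewrite -/(bform _ _ _) => up.
have := Q_psd.2 (plan_state t *m z); rewrite -/(bform _ _ _).
by move: st0; rewrite /stage_cost; lra.
Qed.

(** Drop the first stage and append the input 0 at the origin, which costs nothing; the saving is
    the first stage cost. *)
Lemma plan_shift (z : plan) : plan_state T *m z = 0 ->
  exists z' : plan,
    [/\ forall t, (t <= T)%N -> plan_state t *m z' = plan_state t.+1 *m z
      & bform plan_cost z' z' <= bform plan_cost z z].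
Proof.
move=> zT; pose z' := plan_of (plan_state 1 *m z) (fun t => plan_input t.+1 *m z).
have st t : (t <= T)%N -> plan_state t *m z' = plan_state t.+1 *m z.
  elim: t => [|t IH] tT; first exact: plan_state0_of.
  by rewrite plan_stateS IH ?(ltnW tT) // plan_input_of // [RHS]plan_stateS.
exists z'; split=> //; rewrite !bform_plan_cost.
pose c t := stage_cost (plan_state t *m z) (plan_input t *m z).
have -> : \sum_(t < T) stage_cost (plan_state t *m z') (plan_input t *m z') =
    \sum_(t < T) c t.+1.
  by apply: eq_bigr => t _; rewrite /c plan_input_of // st // ltnW.
have := big_ord_recl T (fun t => c t) : \sum_(t < T.+1) c t = _.
rewrite big_ord_recr /= => E.
have cT : c T = 0.
  by rewrite /c zT plan_input_end mul0mx /stage_cost !bform0r addr0.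
have := stage_cost_ge0 (plan_state 0 *m z) (plan_input 0 *m z).
rewrite -/(c 0%N); move: E; rewrite cT addr0.
by under [X in _ = _ + X]eq_bigr do rewrite /bump add1n; lra.
Qed.

Hypothesis null_ctrl : forall x : 'cV[R]_n, exists z : plan,
  plan_state T *m z = 0 /\ plan_state 0 *m z = x.

Local Notation cost z := (bform plan_cost z z).

(** Pythagoras with [C] the final and [X] the initial state: the minimizer is linear in the initial
    state, and a vanishing remainder gives uniqueness. *)
Lemma optimal_plan : exists S : 'M[R]_(n + \sum_(a < T) m, n),
  [/\ plan_state T *m S = 0, plan_state 0 *m S = 1%:M &
   forall z : plan, plan_state T *m z = 0 ->
     cost (S *m (plan_state 0 *m z)) <= cost z /\
     (cost z <= cost (S *m (plan_state 0 *m z)) ->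
        z = S *m (plan_state 0 *m z))].
Proof.
have [z z0 zx|S [ST S0 Smin]] :=
  constrained_minimizer plan_cost_psd null_ctrl; first exact: plan_cost_eq0.
exists S; split=> // z zT; have -> := Smin z zT.
set d := z - _; split=> [|cz]; first by rewrite lerDl plan_cost_psd.2.
apply/eqP; rewrite -subr_eq0; apply/eqP/plan_cost_eq0; last by rewrite -/d; lra.
by rewrite mulmxBr (mulmxA _ S) S0 mul1mx subrr.
Qed.

Lemma expmxS_mul k (F : 'M[R]_k) j (v : 'cV[R]_k) :
  F ^+ j.+1 *m v = F *m (F ^+ j *m v).
Proof. by rewrite exprS mulmxA. Qed.

(** * Decay under the optimal closed loop *)

Section ClosedLoop.
Variable S : 'M[R]_(n + \sum_(a < T) m, n).
Hypotheses (S_end : plan_state T *m S = 0) (S_start : plan_state 0 *m S = 1%:M).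
Hypothesis S_opt : forall z : plan, plan_state T *m z = 0 ->
  cost (S *m (plan_state 0 *m z)) <= cost z /\
  (cost z <= cost (S *m (plan_state 0 *m z)) -> z = S *m (plan_state 0 *m z)).

Definition closed_loop_mx : 'M[R]_n := plan_state 1 *m S.
Definition value (x : 'cV[R]_n) : R := cost (S *m x).

Local Notation F := closed_loop_mx.

Lemma value_ge0 x : 0 <= value x.
Proof. exact: plan_cost_psd.2. Qed.

(* The shift of an optimal plan is admissible at the next state; if the value
   does not decrease, it is the optimal plan there. *)
Lemma value_next x : value (F *m x) <= value x /\
  (value (F *m x) = value x -> forall t, (t <= T)%N ->
     plan_state t *m (S *m (F *m x)) = plan_state t.+1 *m (S *m x)).
Proof.
have [|z' [st cz']] := @plan_shift (S *m x); first by rewrite mulmxA S_end mul0mx.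
have z'0 : plan_state 0 *m z' = F *m x by rewrite st // mulmxA.
have z'T : plan_state T *m z' = 0.
  rewrite st // plan_stateS plan_input_end mul0mx mulmx0 addr0.
  by rewrite (mulmxA _ S) S_end mul0mx mulmx0.
have := S_opt z'T; rewrite z'0 => -[le_z' eq_z'].
split=> [|eqV t tT]; first exact: le_trans le_z' cz'.
rewrite -st //; congr (_ *m _); apply/esym/eq_z'.
by rewrite -/(value _) eqV.
Qed.

Lemma value_iter_le x j : value (F ^+ j *m x) <= value x.
Proof.
elim: j => [|j IH]; first by rewrite expr0 mul1mx.
by rewrite expmxS_mul; apply: le_trans IH; have [] := value_next (F ^+ j *m x).
Qed.

(** Every optimal plan is then the shift of the one before, so the end point 0 of the first plan is
    the start of the plan at step [T]. *)
Lemma value_stationary x : value (F ^+ T *m x) = value x -> F ^+ T *m x = 0.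
Proof.
move=> eqV.
have eqj j : (j <= T)%N -> value (F ^+ j *m x) = value x.
  move=> jT; apply/eqP; rewrite eq_le value_iter_le -eqV -(subnK jT) exprD.
  by rewrite -[_ * _]/(_ *m _) -mulmxA value_iter_le.
suff H j : (j <= T)%N ->
    plan_state T *m (S *m x) = plan_state (T - j) *m (S *m (F ^+ j *m x)).
  have := H T (leqnn T); rewrite subnn !mulmxA S_end S_start mul0mx mul1mx.
  by move=> <-.
elim: j => [|j IH] jT; first by rewrite subn0 expr0 mul1mx.
rewrite IH ?(ltnW jT) // expmxS_mul.
rewrite (value_next _).2 ?leq_subr -?expmxS_mul ?eqj ?(ltnW jT) //.
by rewrite subnSK.
Qed.

(** The difference of values is a positive semidefinite form in [x], whose null vectors are killed
    by [F ^+ T]; [psd_dominates] applies. *)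
Lemma value_decrease : exists2 c, 0 < c & forall x,
  sqn (F ^+ T *m x) <= c * (value x - value (F ^+ T *m x)).
Proof.
pose P := S^T *m plan_cost *m S.
have valueE x : value x = bform P x x by rewrite /value bform_mulmx.
pose D := P - (F ^+ T)^T *m P *m F ^+ T.
have DE x : bform D x x = value x - value (F ^+ T *m x).
  rewrite !valueE bform_mulmx /D {1}/bform mulmxBr mulmxBl mxE; congr (_ + _).
  by rewrite mxE.
have Ps : P^T = P by rewrite /P !trmx_mul trmxK plan_cost_psd.1 mulmxA.
have pD : psd D.
  split=> [|x]; first by rewrite /D linearB /= Ps (trmx_mul _ (F ^+ T))
    (trmx_mul _ P) trmxK Ps mulmxA.
  by rewrite -/(bform _ _ _) DE subr_ge0 value_iter_le.
have [x|c c0 Hc] := psd_dominates (G := F ^+ T) pD.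
  by rewrite DE => /eqP; rewrite subr_eq0 eq_sym => /eqP/value_stationary.
by exists c => // x; rewrite -DE.
Qed.

Lemma closed_loop_contraction (eps : R) : 0 < eps ->
  exists p, forall x, sqn (F ^+ p *m x) <= eps * sqn x.
Proof.
move=> eps0; have [c c0 Hc] := value_decrease.
have [d d0 Hd] := bform_le_sqn (S^T *m plan_cost *m S).
(* As [value y <= d * sqn y], the decrease bounds [(1 + 1 / (c d))] times the value after [T] steps
   by [value x]. *)
pose r := (1 + (c * d)^-1)^-1.
have cd : 0 < (c * d)^-1 by rewrite invr_gt0 mulr_gt0.
have r0 : 0 < r by rewrite invr_gt0 addr_gt0.
have r1 : r < 1 by rewrite invf_lt1 ?addr_gt0 // ltrDl.
have step x : value (F ^+ T *m x) <= r * value x.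
  rewrite mulrC ler_pdivlMr ?addr_gt0 // mulrDr mulr1.
  have h1 := Hc x; have h2 := Hd (F ^+ T *m x).
  rewrite -bform_mulmx -/(value _) in h2.
  have : value (F ^+ T *m x) / (c * d) <= value x - value (F ^+ T *m x).
    rewrite ler_pdivrMr ?mulr_gt0 //.
    rewrite mulrC -mulrA mulrCA.
    by apply: (le_trans h2); rewrite ler_pM2l.
  by lra.
have steps k x : value (F ^+ (T * k) *m x) <= r ^+ k * value x.
  elim: k => [|k IH]; first by rewrite muln0 !expr0 mul1mx mul1r.
  rewrite mulnS exprD -[_ * _]/(_ *m _) -mulmxA exprS -mulrA.
  by apply: le_trans (step _) _; rewrite ler_pM2l.
have /cvgr0_norm_lt : (GRing.exp r : R^nat) @ \oo --> 0.
  by apply: cvg_expr; rewrite gtr0_norm.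
move=> /(_ (eps / (c * d))) [|k _ /(_ k (leqnn k))].
  by rewrite divr_gt0 // mulr_gt0.
rewrite /= ger0_norm ?exprn_ge0 ?(ltW r0) // => rk.
(* A small value need not mean a small state: after [T * k] steps of decay, [T] further steps turn
   the value into a norm bound through [Hc]. *)
exists (T + T * k)%N => x.
rewrite exprD -[_ * _]/(_ *m _) -mulmxA; apply: (le_trans (Hc _)).
have h0 := value_ge0 (F ^+ T *m (F ^+ (T * k) *m x)).
apply: (@le_trans _ _ (c * (r ^+ k * value x))).
  by rewrite ler_pM2l //; apply: le_trans (steps k x); lra.
rewrite mulrCA; apply: (@le_trans _ _ (r ^+ k * (c * (d * sqn x)))).
  by rewrite ler_pM2l ?exprn_gt0 // ler_pM2l // /value bform_mulmx.
rewrite [c * _]mulrA mulrA; apply: ler_wpM2r; first exact: sqn_ge0.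
by move/ltW: rk; rewrite ler_pdivlMr ?mulr_gt0.
Qed.

End ClosedLoop.

End LinearQuadratic.

(** * Perturbations of a contraction *)

Section Perturbation.
Context {R : realType}.

(** The working norm, with a termwise triangle inequality; [l1_le_enorm] and [enorm_le_l1] link it
    to the Euclidean norm. *)
Definition l1 {k} (v : 'cV[R]_k) : R := \sum_i `|v i 0|.

Lemma l1_ge0 k (v : 'cV[R]_k) : 0 <= l1 v.
Proof. exact: sumr_ge0. Qed.

Lemma l10 k : l1 (0 : 'cV[R]_k) = 0.
Proof. by apply: big1 => i _; rewrite mxE normr0. Qed.

Lemma l1D k (v w : 'cV[R]_k) : l1 (v + w) <= l1 v + l1 w.
Proof. by rewrite -big_split ler_sum // => i _; rewrite mxE ler_normD. Qed.

Lemma l1_mulmx k l (M : 'M[R]_(l, k)) :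
  exists2 c, 0 < c & forall v, l1 (M *m v) <= c * l1 v.
Proof.
exists (1 + \sum_i \sum_j `|M i j|).
  by apply: ltr_pwDl => //; apply: sumr_ge0 => i _; apply: sumr_ge0.
move=> v; rewrite mulrDl mul1r.
apply: (@le_trans _ _ ((\sum_i \sum_j `|M i j|) * l1 v)); last by rewrite lerDr l1_ge0.
rewrite mulr_suml; apply: ler_sum => i _; rewrite mxE.
apply: (le_trans (ler_norm_sum _ _ _)); rewrite mulr_suml; apply: ler_sum => j _.
rewrite normrM ler_wpM2l // /l1 (bigD1 j) //= lerDl.
exact: sumr_ge0.
Qed.

Lemma enorm_ge0 k (v : 'cV[R]_k) : 0 <= enorm v.
Proof. exact: sqrtr_ge0. Qed.

Lemma sqr_enorm k (v : 'cV[R]_k) : enorm v ^+ 2 = sqn v.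
Proof. by rewrite sqr_sqrtr // sqn_ge0. Qed.

Lemma norm_le_enorm k (v : 'cV[R]_k) i : `|v i 0| <= enorm v.
Proof. by rewrite -sqrtr_sqr ler_wsqrtr // sqr_le_sqn. Qed.

Lemma l1_le_enorm k (v : 'cV[R]_k) : l1 v <= k%:R * enorm v.
Proof.
rewrite mulr_natl -[X in _ *+ X](card_ord k) -sumr_const.
by apply: ler_sum => i _; exact: norm_le_enorm.
Qed.

Lemma enorm_le_l1 k (v : 'cV[R]_k) : enorm v <= l1 v.
Proof.
rewrite -ler_sqr ?nnegrE ?enorm_ge0 ?l1_ge0 // sqr_enorm expr2 {1}/l1 mulr_suml.
apply: ler_sum => i _; rewrite -real_normK ?num_real // expr2 ler_wpM2l // /l1 (bigD1 i) //= lerDl.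
exact: sumr_ge0.
Qed.

Lemma enorm_stackt k T (w : signal R k) t : (t < T)%N ->
  enorm (w t) <= enorm (stackt T w).
Proof.
move=> tT; apply: ler_wsqrtr; rewrite -[leRHS]/(sqn _) sqnE.
rewrite /stackt tr_mxcol mul_mxrow_mxcol summxE (bigD1 (Ordinal tT)) //=.
rewrite -sqnE lerDl; apply: sumr_ge0 => a _; rewrite -sqnE; exact: sqn_ge0.
Qed.

Lemma l1_contraction k (F : 'M[R]_k) :
  (forall eps, 0 < eps -> exists p, forall x, sqn (F ^+ p *m x) <= eps * sqn x) ->
  exists p, forall x, 2 * l1 (F ^+ p *m x) <= l1 x.
Proof.
(* [4 * k^2] is the cost of passing from [sqn] to the square of [2 * l1]; the added 1 keeps [e]
   positive when [k = 0]. *)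
pose e : R := (1 + 4 * k%:R ^+ 2).
have e0 : 0 < e by rewrite /e ltr_pwDl // mulr_ge0 ?sqr_ge0.
move=> /(_ e^-1) []; first by rewrite invr_gt0.
move=> p Hp; exists p => x.
rewrite -ler_sqr ?nnegrE ?mulr_ge0 ?l1_ge0 //.
apply: (@le_trans _ _ (sqn x)); last first.
  by rewrite -sqr_enorm ler_sqr ?nnegrE ?enorm_ge0 ?l1_ge0 // enorm_le_l1.
have := Hp x; rewrite mulrC ler_pdivlMr // => Hx.
apply: le_trans Hx; have := l1_le_enorm (F ^+ p *m x).
rewrite -ler_sqr ?nnegrE ?mulr_ge0 ?l1_ge0 ?enorm_ge0 // exprMn sqr_enorm.
have := sqn_ge0 (F ^+ p *m x); rewrite /e; nra.
Qed.

(** [N] sums [l1] over [p] iterates: applying [F] trades the term [l1 x] for [l1 (F ^+ p *m x)], at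
    most half of it, and [l1 x] is at least a fixed fraction of [N x]. *)
Lemma lyapunov_norm k (F : 'M[R]_k) p :
  (forall x, 2 * l1 (F ^+ p *m x) <= l1 x) ->
  exists (N : 'cV[R]_k -> R) (c rho : R),
    [/\ 0 < c, 0 < rho < 1, forall x, l1 x <= N x <= c * l1 x,
      forall x y, N (x + y) <= N x + N y & forall x, N (F *m x) <= rho * N x].
Proof.
move=> contr; pose N (x : 'cV[R]_k) := \sum_(j < p) l1 (F ^+ j *m x).
have [b Hb] : exists2 c, 1 <= c & forall x, N x <= c * l1 x.
  have /choice [cs Hcs] (j : nat) : exists c, 0 < c /\ forall v, l1 (F ^+ j *m v) <= c * l1 v.
    by have [c] := l1_mulmx (F ^+ j); exists c.
  exists (1 + \sum_(j < p) cs j) => [|x].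
    by rewrite lerDl; apply: sumr_ge0 => j _; rewrite ltW // (Hcs j).1.
  rewrite mulrDl mul1r mulr_suml; apply: ler_wpDl; first exact: l1_ge0.
  by apply: ler_sum => j _; exact: (Hcs j).2.
move=> HN.
have l1N x : l1 x <= N x.
  (* For [p = 0] the assumption forces [l1 x = 0], so the empty sum still dominates. *)
  rewrite /N; case: p contr {N HN Hb b} => [|p] contr.
    by have := contr x; rewrite expr0 mul1mx big_ord0; have := l1_ge0 x; lra.
  rewrite big_ord_recl expr0 mul1mx lerDl; apply: sumr_ge0 => j _; exact: l1_ge0.
have b0 : 0 < b by apply: lt_le_trans Hb.
have b2 : 0 < b * 2 by rewrite mulr_gt0.
have ib : 0 < (b * 2)^-1 < 1.
  rewrite invr_gt0 b2 invf_lt1 //; lra.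
exists N, b, (1 - (b * 2)^-1); split=> //.
- by move: ib; lra.
- by move=> x; rewrite l1N HN.
- move=> x y; rewrite -big_split; apply: ler_sum => j _; rewrite mulmxDr.
  exact: l1D.
move=> x; have -> : N (F *m x) = N x - l1 x + l1 (F ^+ p *m x).
  have E : \sum_(j < p.+1) l1 (F ^+ j *m x) = N x + l1 (F ^+ p *m x).
    by rewrite big_ord_recr.
  move: E; rewrite big_ord_recl expr0 mul1mx.
  rewrite (eq_bigr (fun j : 'I_p => l1 (F ^+ j *m (F *m x)))); last first.
    by move=> j _; rewrite lift0 exprSr mulmxA.
  rewrite -/(N _); lra.
have := contr x; have : N x / (b * 2) <= l1 x / 2.
  rewrite ler_pdivrMr //; have := HN x; lra.
by rewrite mulrBl mul1r [_^-1 * _]mulrC; lra.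
Qed.

Lemma geometric_cvg0 (a : nat -> R) (r C : R) : 0 < r < 1 ->
  (forall t, 0 <= a t <= r ^+ t * C) -> a @ \oo --> 0.
Proof.
move=> /andP [r0 r1] H.
apply: (@squeeze_cvgr _ _ _ _ (fun=> 0) (fun t => r ^+ t * C)).
- by apply: nearW => t; exact: H.
- exact: cvg_cst.
rewrite -(mul0r C); apply: cvgMl; apply: cvg_expr; by rewrite gtr0_norm.
Qed.

(* a(t+1) + (1 - rho)/2 a(t) decays at the rate (1 + rho)/2. *)
Lemma delayed_decay (a : nat -> R) (rho e : R) : 0 < rho < 1 ->
  e <= (1 + rho) / 2 * ((1 - rho) / 2) -> (forall t, 0 <= a t) ->
  (forall t, a t.+2 <= rho * a t.+1 + e * a t) ->
  forall t, a t.+1 <= ((1 + rho) / 2) ^+ t * (a 1%N + a 0%N).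
Proof.
move=> /andP [r0 r1] le_e a0 rec t.
have H : a t.+1 + (1 - rho) / 2 * a t <=
    ((1 + rho) / 2) ^+ t * (a 1%N + (1 - rho) / 2 * a 0%N).
  elim: t => [|t IH]; first by rewrite expr0 mul1r.
  rewrite exprS -[leRHS]mulrA.
  apply: (@le_trans _ _ ((1 + rho) / 2 * (a t.+1 + (1 - rho) / 2 * a t))).
    (* [rho + (1 - rho) / 2] is the new rate, and the bound on [e] fits the delayed term into the
       second weight. *)
    by have := rec t; have := a0 t; have := a0 t.+1; nra.
  by rewrite ler_pM2l //; lra.
have h1 := a0 t; have h2 := a0 0%N; have h3 : 0 <= (1 - rho) / 2 <= 1 by lra.
apply: (@le_trans _ _ (a t.+1 + (1 - rho) / 2 * a t)); first by nra.
apply: (le_trans H); rewrite ler_wpM2l ?exprn_ge0 //; first by lra.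
by nra.
Qed.

End Perturbation.

(** * The closed loop of the algorithm *)

Section ModelPredictiveControl.
Context {R : realType} {n m : nat} (A : 'M[R]_n) (B : 'M[R]_(n, m)).

(** A row vector killing [A] and [B] kills every state reached in at least one step, so [[A B]] has
    full row rank; its right inverse splits into [X] and [U]. *)
Lemma controllable_predecessor : controllable A B ->
  exists (X : 'M[R]_n) (U : 'M[R]_(m, n)), A *m X + B *m U = 1%:M.
Proof.
move=> ctrl; have /row_freeP [D HD] : row_free (row_mx A B).
  apply: inj_row_free => v; rewrite mul_mx_row -[RHS]row_mx0 => /eq_row_mx [vA vB].
  apply/rowP => j; rewrite mxE.
  have [[|L] [u [x [tr x0 xL]]]] := ctrl 0 (delta_mx j 0).
    by have := colE j v; rewrite -xL x0 mulmx0 => /colP/(_ 0); rewrite !mxE.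
  have : v *m x L.+1 = 0 by rewrite tr // mulmxDr !mulmxA vA vB !mul0mx addr0.
  by rewrite xL -colE => /colP/(_ 0); rewrite !mxE.
exists (usubmx D), (dsubmx D).
by rewrite -HD -[D in RHS]vsubmxK mul_row_col.
Qed.

(** Iterating [X] backward from [x] builds a history whose last state is controlled by the norm of
    [x]. *)
Lemma past_trajectory (X : 'M[R]_n) (U : 'M[R]_(m, n)) Tini (x : 'cV[R]_n) :
  A *m X + B *m U = 1%:M -> (0 < Tini)%N ->
  exists uini xini, [/\ trajectory A B Tini uini xini,
    A *m xini Tini.-1 + B *m uini Tini.-1 = x & xini Tini.-1 = X *m x].
Proof.
move=> XU Tini0.
exists (fun s => U *m (X ^+ (Tini - s.+1) *m x)), (fun s => X *m (X ^+ (Tini - s.+1) *m x)).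
have XUx y : A *m (X *m y) + B *m (U *m y) = y.
  by rewrite !mulmxA -mulmxDl XU mul1mx.
split=> [s sT||]; rewrite ?XUx.
- by rewrite -expmxS_mul -subSn // subSS.
- by rewrite prednK // subnn expr0 mul1mx.
- by rewrite prednK // subnn expr0 mul1mx.
Qed.

Lemma concat_future k L (w1 w2 : signal R k) t : concat L w1 w2 (L + t)%N = w2 t.
Proof. by rewrite /concat ltnNge leq_addr addKn. Qed.

(** The dynamics across the junction, from [Tini.-1] to [Tini], fix the first future state. *)
Lemma trajectory_concatP Tini T uini xini (u : signal R m) (x : signal R n) :
  (0 < Tini)%N -> trajectory A B Tini uini xini ->
  trajectory A B (Tini + T + 1) (concat Tini uini u) (concat Tini xini x) <->
  x 0%N = A *m xini Tini.-1 + B *m uini Tini.-1 /\ trajectory A B T.+1 u x.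
Proof.
move=> Tini0 trini; split=> [tr|[x0 tr] t tT].
  split=> [|t tT].
    have := tr Tini.-1; rewrite /concat prednK // ltnn subnn leqnn; apply; lia.
  by have := tr (Tini + t)%N; rewrite -addnS !concat_future; apply; lia.
have [tTini|Tinit] := ltnP t.+1 Tini.
  by rewrite /concat tTini ltnW // trini.
have [tTini|{}Tinit] := ltnP t Tini.
  have -> : t = Tini.-1 by lia.
  by rewrite /concat prednK // ltnn subnn leqnn.
rewrite -(subnKC Tinit) -addnS !concat_future tr //; lia.
Qed.

End ModelPredictiveControl.

(** * The cost of (P) as a quadratic cost *)

Section Cost.
Context {R : realType} (net : network R).
Local Notation node := 'I_(nnodes net).
Local Notation S := (act net).
Variables (Q : forall i : node, 'M[R]_(xdim i)) (Rw : forall i : node, 'M[R]_(udim i)).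

Definition state_weight : 'M[R]_(ndim net) := \mxdiag_i Q i.
Definition input_weight : 'M[R]_(mdim net) := \mxdiag_k Rw (actn k).

Lemma bform_mxdiag p (p_ : 'I_p -> nat) (M : forall i, 'M[R]_(p_ i)) v :
  bform (\mxdiag_i M i) v v = \sum_i bform (M i) (submxcol v i) (submxcol v i).
Proof.
rewrite /bform -mulmxA -[in LHS](submxcolK v) mul_mxdiag_mxcol tr_mxcol.
by rewrite mul_mxrow_mxcol summxE; apply: eq_bigr => i _; rewrite mulmxA.
Qed.

Lemma wnorm_sqr k (M : 'M[R]_k) v : psd M -> wnorm M v ^+ 2 = bform M v v.
Proof. by move=> pM; rewrite sqr_sqrtr // pM.2. Qed.

Hypotheses (Q_psd : forall i, psd (Q i)) (Rw_posdef : forall i, i \in S -> posdef (Rw i)).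

Lemma state_weight_psd : psd state_weight.
Proof.
split=> [|x]; first by rewrite tr_mxdiag; apply/eq_mxdiag => i; rewrite (Q_psd i).1.
rewrite -/(bform _ _ _) bform_mxdiag; apply: sumr_ge0 => i _; exact: (Q_psd i).2.
Qed.

Lemma actn_posdef (k : 'I_#|S|) : posdef (Rw (actn k)).
Proof. exact/Rw_posdef/enum_valP. Qed.

Lemma input_weight_posdef : posdef input_weight.
Proof.
split=> [|u u0].
  by rewrite tr_mxdiag; apply/eq_mxdiag => k; rewrite (actn_posdef k).1.
rewrite -/(bform _ _ _) bform_mxdiag.
have ge0 k : 0 <= bform (Rw (actn k)) (submxcol u k) (submxcol u k).
  exact: (Rw_psd (actn_posdef k)).2.
rewrite lt_def sumr_ge0 // andbT; apply: contraNneq u0 => /psumr_eq0P H.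
apply/eqP/mxcolP => k; rewrite submxcol0; apply: contraTeq isT => /(actn_posdef k).2.
by rewrite -/(bform _ _ _) H // ltxx.
Qed.

Lemma cost_stage_cost T u x : cost T Q Rw u x =
  \sum_(t < T) stage_cost state_weight input_weight (x t) (u t).
Proof.
rewrite /stage_cost big_split /=.
under [X in _ = X + _]eq_bigr do rewrite bform_mxdiag.
under [X in _ = _ + X]eq_bigr do rewrite bform_mxdiag.
rewrite [X in _ = X + _]exchange_big [X in _ = _ + X]exchange_big /=.
rewrite (bigID (mem S)) /= /cost addrAC; congr (_ + _); last first.
  apply: eq_big => [i|i _]; first by rewrite inE.
  by apply: eq_bigr => t _; rewrite wnorm_sqr.
rewrite (big_enum_val (fun i => \sum_(t < T) bform (Q i) (submxcol (x t) i) (submxcol (x t) i))).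
rewrite -big_split; apply: eq_bigr => k _; rewrite -big_split.
apply: eq_bigr => t _; rewrite !wnorm_sqr //; exact: Rw_psd (actn_posdef k).
Qed.

End Cost.
Section Algorithm.
Context {R : realType} (net : network R).
Local Notation A := (Amx net).
Local Notation B := (Bmx net).
Variables (Td Tini T : nat) (ud : signal R (mdim net)) (xd : signal R (ndim net)).
Variables (Q : forall i : 'I_(nnodes net), 'M[R]_(xdim i))
          (Rw : forall i : 'I_(nnodes net), 'M[R]_(udim i)).
Hypotheses (Tini_gt0 : (0 < Tini)%N) (Q_psd : forall i, psd (Q i))
  (Rw_posdef : forall i, i \in act net -> posdef (Rw i))
  (ctrl : controllable A B) (data : trajectory A B Td ud xd)
  (excitation : global_excitation Td Tini T ud \/ local_excitation Td Tini T ud xd)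
  (feas : forall uini xini, trajectory A B Tini uini xini ->
     exists g u x, feasible Td Tini T ud xd uini xini g u x).

(** Eliminates the multipliers: the past enters only through the current state. *)
Lemma feasibleP uini xini u x : trajectory A B Tini uini xini ->
  (exists g, feasible Td Tini T ud xd uini xini g u x) <->
  [/\ x 0%N = next_state Tini uini xini, trajectory A B T.+1 u x & x T = 0].
Proof.
move=> trini; split=> [[g /(feasible_trajectory data) [tr xT]]|[x0 tr xT]].
  by have [] := (trajectory_concatP T u x Tini_gt0 trini).1 tr.
by apply: trajectory_feasible => //; apply/(trajectory_concatP T u x Tini_gt0 trini).
Qed.

(** Every state is the successor of some past trajectory, so feasibility of (P) supplies a plan from
    it to the origin. *)
Lemma steerable (x0 : 'cV[R]_(ndim net)) :
  exists z, plan_state A B T T *m z = 0 /\ plan_state A B T 0 *m z = x0.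
Proof.
have [X [U XU]] := controllable_predecessor ctrl.
have [uini [xini [trini nx _]]] := past_trajectory x0 XU Tini_gt0.
have [g [u [x fx]]] := feas trini.
have [|x00 tr xT] := (feasibleP u x trini).1; first by exists g.
exists (plan_of T (x 0%N) u).
by rewrite plan_state_of // plan_state0_of x00 -nx.
Qed.

Local Notation J := (plan_cost A B (state_weight Q) (input_weight Rw) T).

(** The plan generated by [S] is itself feasible for (P), so an optimum of (P) costs no more and
    coincides with it by uniqueness. *)
Lemma optimal_input (S : 'M[R]_(ndim net + \sum_(a < T) mdim net, ndim net))
    uini xini (g : multipliers net Td Tini T) u x :
  plan_state A B T T *m S = 0 -> plan_state A B T 0 *m S = 1%:M ->
  (forall z, plan_state A B T T *m z = 0 ->
     bform J z z <= bform J (S *m (plan_state A B T 0 *m z)) (S *m (plan_state A B T 0 *m z)) ->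
     z = S *m (plan_state A B T 0 *m z)) ->
  (0 < T)%N -> trajectory A B Tini uini xini ->
  optimal ud xd Q Rw uini xini g u x ->
  plan_state A B T 1 *m S *m next_state Tini uini xini =
  A *m next_state Tini uini xini + B *m u 0%N.
Proof.
move=> S_end S_start S_opt T0 trini [fx opt].
have [|x0 tr xT] := (feasibleP u x trini).1; first by exists g.
rewrite -x0; set z := plan_of T (x 0%N) u.
have zx t : (t <= T)%N -> plan_state A B T t *m z = x t by exact: plan_state_of.
have zu t : (t < T)%N -> plan_input T t *m z = u t by exact: plan_input_of.
rewrite -(mulmxA _ S); suff <- : z = S *m x 0%N by rewrite plan_stateS zx // zu.
have := S_opt z; rewrite !zx //; apply=> //.
set z' := S *m x 0%N.
have [|g' fx'] := (feasibleP (fun t => plan_input T t *m z')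
  (fun t => plan_state A B T t *m z') trini).2.
  split=> [||]; first by rewrite mulmxA S_start mul1mx.
  - exact: plan_trajectory.
  - by rewrite mulmxA S_end mul0mx.
have := opt _ _ _ fx'; rewrite !cost_stage_cost // !bform_plan_cost.
congr (_ <= _); apply: eq_bigr => t _; by rewrite zx ?zu // ltnW.
Qed.

(* With T = 0, feasibility for every past forces the state space to be
   trivial; with T > 0, the error is that of the first input. *)
Lemma nominal_closed_loop : exists (F : 'M[R]_(ndim net)) (p : nat) (c : R),
  [/\ forall x, 2 * l1 (F ^+ p *m x) <= l1 x, 0 < c &
   forall delta uini xini v, 0 <= delta -> trajectory A B Tini uini xini ->
     algorithm_input Td Tini T ud xd Q Rw delta uini xini v ->
     l1 (A *m next_state Tini uini xini + B *m v - F *m next_state Tini uini xini)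
       <= delta * c * l1 (xini Tini.-1)].
Proof.
have [S [S_end S_start S_opt]] :=
  optimal_plan (state_weight_psd Q_psd) (input_weight_posdef Rw_posdef) steerable.
pose F := plan_state A B T 1 *m S.
have [p Hp] := l1_contraction (closed_loop_contraction (state_weight_psd Q_psd)
  (input_weight_posdef Rw_posdef) S_end S_start S_opt).
have [b b0 Hb] := l1_mulmx B.
(* [b] bounds [B] in [l1], and [mdim net] converts the Euclidean tolerance to [l1]; the added 1
   ensures positivity. *)
exists F, p, (b * (1 + (mdim net)%:R)); split=> //.
  by rewrite mulr_gt0 // ltr_pwDl.
move=> delta uini xini v d0 trini; rewrite /algorithm_input.
set x := next_state Tini uini xini.
have rhs0 : 0 <= delta * (b * (1 + (mdim net)%:R)) * l1 (xini Tini.-1).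
  by rewrite !mulr_ge0 ?l1_ge0 ?addr_ge0 // ltW.
case: eqVneq => [-> ->|_ [g [us [xs [uhat [opt close ->]]]]]].
  by rewrite !mulmx0 addr0 subr0 l10.
have [T0|T0] := posnP T.
  have triv (y : 'cV[R]_(ndim net)) : y = 0.
    by rewrite -(mul1mx y) -S_start -[X in plan_state _ _ _ X]T0 S_end mul0mx.
  by rewrite (triv (_ - _)) l10.
rewrite (optimal_input S_end S_start _ T0 trini opt); last first.
  by move=> z /S_opt [].
rewrite opprD addrACA subrr add0r -mulmxBr; apply: (le_trans (Hb _)).
have h := enorm_stackt (fun t => uhat t - us t) T0.
have h1 := l1_le_enorm (uhat 0%N - us 0%N).
have h2 : enorm (uhat 0%N - us 0%N) <= delta * l1 (xini Tini.-1).
  apply: (le_trans h); apply: (le_trans close); rewrite ler_wpM2l //.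
  by apply: le_trans (enorm_le_l1 _); rewrite ge_min lexx orbT.
rewrite mulrCA -mulrA ler_pM2l //; apply: (le_trans h1).
rewrite (mulrC delta) -mulrA; apply: ler_pM; rewrite ?enorm_ge0 ?ler0n ?lerDr //.
Qed.

End Algorithm.

Theorem theoremV2 (R : realType) (net : network R) (Td Tini T : nat)
    (ud : signal R (mdim net)) (xd : signal R (ndim net))
    (Q : forall i : 'I_(nnodes net), 'M[R]_(xdim i))
    (Rw : forall i : 'I_(nnodes net), 'M[R]_(udim i))
    (Tini_gt0 : (0 < Tini)%N)
    (Q_psd : forall i, psd (Q i))
    (Rw_posdef : forall i : 'I_(nnodes net), i \in act net -> posdef (Rw i))
    (ctrl : controllable (Amx net) (Bmx net))
    (data : trajectory (Amx net) (Bmx net) Td ud xd)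
    (excitation : global_excitation Td Tini T ud \/
                  local_excitation Td Tini T ud xd)
    (feas : forall uini xini,
       trajectory (Amx net) (Bmx net) Tini uini xini ->
       exists g u x, feasible Td Tini T ud xd uini xini g u x) :
  exists2 deltastar : R, 0 < deltastar &
    forall delta : R, 0 < delta < deltastar ->
      (forall phi : 'cV[R]_(ndim net) -> 'cV[R]_(mdim net),
         algorithm_feedback Td Tini T ud xd Q Rw delta phi ->
         globally_asymptotically_stable
           (fun x => Amx net *m x + Bmx net *m phi x)) /\
      algorithm_runs_stable Td Tini T ud xd Q Rw delta.
Proof.
have [F [p [c [contr c0 err]]]] :=
  nominal_closed_loop Tini_gt0 Q_psd Rw_posdef ctrl data excitation feas.
have [N [b [rho [b0 rho01 HN NB NF]]]] := lyapunov_norm contr.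
have [X [U XU]] := controllable_predecessor ctrl.
have [h h0 HX] := l1_mulmx X.
pose gam := (1 - rho) / 2; pose sig := (1 + rho) / 2.
have [r0 r1] := andP rho01.
have gam0 : 0 < gam by rewrite /gam; lra.
have sig01 : 0 < sig < 1 by rewrite /sig; lra.
have [sig0 sig1] := andP sig01.
(* [delta * K] dominates both the coefficient of the error in terms of the previous state and,
   through the factor [h], in terms of the current state when the previous one is [X *m x]. *)
pose K := b * c * (1 + h).
have K0 : 0 < K by rewrite !mulr_gt0 // addr_gt0.
exists (sig * gam / K) => [|delta /andP [d0 dlt]]; first by apply: divr_gt0 => //; apply: mulr_gt0.
have dK : delta * K <= sig * gam by rewrite -ler_pdivlMr // ltW.
have bcd : 0 < b * (delta * c) by rewrite !mulr_gt0.
have N0 x : 0 <= N x by apply: le_trans (l1_ge0 x) _; have /andP [] := HN x.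
have l1N x : l1 x <= N x by have /andP [] := HN x.
have Nl1 x : N x <= b * l1 x by have /andP [] := HN x.
have EN x : enorm x <= N x := le_trans (enorm_le_l1 x) (l1N x).
have NE x : N x <= b * (1 + (ndim net)%:R) * enorm x.
  apply: (le_trans (Nl1 x)); rewrite -mulrA ler_pM2l //.
  apply: (le_trans (l1_le_enorm x)); rewrite ler_wpM2r ?enorm_ge0 //; lra.
pose M := b * (1 + (ndim net)%:R : R).
have M0 : 0 < M by rewrite mulr_gt0 // ltr_pwDl.
have step uini xini v : trajectory (Amx net) (Bmx net) Tini uini xini ->
    algorithm_input Td Tini T ud xd Q Rw delta uini xini v ->
    N (Amx net *m next_state Tini uini xini + Bmx net *m v) <=
    rho * N (next_state Tini uini xini) + b * (delta * c) * l1 (xini Tini.-1).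
  move=> tr alg; have := err delta uini xini v (ltW d0) tr alg.
  set x := next_state _ _ _; set y := Amx net *m x + _ => e.
  rewrite -[y](subrKC (F *m x)); apply: (le_trans (NB _ _)); rewrite lerD ?NF //.
  by apply: (le_trans (Nl1 _)); rewrite -mulrA ler_pM2l.
split=> [phi [phi0 alg]|].
  pose f x := Amx net *m x + Bmx net *m phi x.
  (* Choosing the history with last state [X *m x] makes the error at most [gam * N x], and
     [rho + gam = sig]. *)
  have Nf x : N (f x) <= sig * N x.
    have [uini [xini [tr nx lastx]]] := past_trajectory x XU Tini_gt0.
    have := step _ _ _ tr (alg _ _ tr); rewrite /next_state nx lastx -/(f x).
    move=> /le_trans; apply.
    have hl := HX x; have ln := l1N x; have Nx := N0 x.
    have : b * (delta * c) * l1 (X *m x) <= gam * N x.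
      apply: (@le_trans _ _ (b * (delta * c) * (h * N x))).
        by rewrite ler_pM2l //; apply: (le_trans hl); rewrite ler_pM2l.
      rewrite [leLHS]mulrA; apply: ler_wpM2r => //.
      have : b * (delta * c) * h <= delta * K.
        have -> : delta * K = b * (delta * c) + b * (delta * c) * h.
          by rewrite /K; ring.
        by rewrite lerDr ltW.
      move=> /le_trans; apply; apply: (le_trans dK).
      by rewrite ger_pMl // ltW.
    by rewrite /sig /gam; lra.
  have iterN x t : N (iter t f x) <= sig ^+ t * N x.
    elim: t => [|t IH]; first by rewrite mul1r.
    rewrite exprS -mulrA; apply: (le_trans (Nf _)).
    by rewrite ler_pM2l.
  split=> [eps eps0|x0].
    exists (eps / M) => [|x0]; first by rewrite divr_gt0.
    rewrite ltr_pdivlMr // mulrC => x0d t.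
    apply: le_lt_trans x0d; apply: (le_trans (EN _)); apply: (le_trans (iterN _ _)).
    apply: le_trans (NE x0); by rewrite ler_piMl // exprn_ile1 // ltW.
  apply: (geometric_cvg0 (C := N x0) sig01) => t.
  by rewrite enorm_ge0 (le_trans (EN _)).
have run u x : algorithm_run Td Tini T ud xd Q Rw delta u x ->
    forall t, enorm (x (Tini + t)%N) <= sig ^+ t * (N (x Tini) + N (x Tini.-1)).
  move=> [tr alg] t; apply: (le_trans (EN _)).
  (* Starting at [Tini.-1] makes [a 0] and [a 1] the two parts of the initial condition. *)
  pose a t := N (x (Tini.-1 + t)%N).
  have aE s : N (x (Tini + s)%N) = a s.+1 by rewrite /a -addSnnS prednK.
  have := @delayed_decay _ a rho (b * (delta * c)) rho01.
  rewrite aE -(addn0 Tini) aE addn0 /a addn0; apply.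
  - apply: (le_trans _ dK).
    have -> : delta * K = b * (delta * c) + b * (delta * c) * h by rewrite /K; ring.
    by rewrite lerDl mulr_ge0 // ltW.
  - by move=> s; exact: N0.
  move=> s.
  have nx : next_state Tini (fun r => u (s + r)%N) (fun r => x (s + r)%N) = x (Tini + s)%N.
    by rewrite /next_state -tr -addnS prednK // addnC.
  have tr' : trajectory (Amx net) (Bmx net) Tini (fun r => u (s + r)%N) (fun r => x (s + r)%N).
    by move=> r _; rewrite addnS tr.
  have := step _ _ _ tr' (alg s); rewrite nx (addnC s) -tr (addnC s) -addnS !aE.
  move=> /le_trans; apply; rewrite lerD2l ler_pM2l //; exact: l1N.
split=> [eps eps0|u x /run H].
  (* Each of the two initial terms contributes less than [eps / 2]. *)
  exists (eps / (2 * M)) => [|u x /run H]; first by rewrite divr_gt0 ?mulr_gt0.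
  rewrite !ltr_pdivlMr ?mulr_gt0 // => xd1 xd2 t.
  apply: (le_lt_trans (H t)).
  apply: (@le_lt_trans _ _ (N (x Tini) + N (x Tini.-1))).
    by rewrite ler_piMl ?addr_ge0 // exprn_ile1 // ltW.
  have := NE (x Tini); have := NE (x Tini.-1); rewrite -/M => n1 n2; lra.
rewrite -(cvg_shiftn Tini).
apply: (geometric_cvg0 (C := N (x Tini) + N (x Tini.-1)) sig01) => t.
by rewrite enorm_ge0 /= addnC H.
Qed.
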